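(* Let $p\in[1,\infty)$, $\kappa$ an infinite cardinal, and $Y$ a real normed space with $\mathrm{dens}(Y)<\kappa$. Then: (i) For $1\le r\le p$, $\gamma(\ell_p(\kappa)\oplus_rY)=\gamma^*(\ell_p(\kappa)\oplus_rY)=\frac{2}{2^{1/p}}$. (ii) For $p\le r<\infty$, $\frac{2}{2^{1/p}}\le\gamma(\ell_p(\kappa)\oplus_rY)\le\gamma^*(\ell_p(\kappa)\oplus_rY)\le\frac{2}{2^{1/r}}$. (iii) For $r=\infty$, $\frac{2}{2^{1/p}}\le\gamma(\ell_p(\kappa)\oplus_\infty Y)\le\gamma^*(\ell_p(\kappa)\oplus_\infty Y)\le\max\left\{\frac{2}{2^{1/p}},\gamma^*(Y)\right\}$.
   Context: $\mathrm{dens}(Y)$ is the smallest cardinality of a subset of $Y$ whose linear span is dense in $Y$ (so $\mathrm{dens}(Y)<\omega$ means $Y$ is finite-dimensional). $\ell_p(\kappa)$ is the real $\ell_p$ space over an index set of cardinality $\kappa$. $X\oplus_rY$ is $X\times Y$ with norm $(\|x\|^r+\|y\|^r)^{1/r}$ (maximum if $r=\infty$). A set $P\subseteq X$ is $s$-separated if $\|x-y\|\ge s$ for all distinct $x,y\in P$, and $s$-dense if for every $x\in X$ there is $u\in P$ with $\|x-u\|\le s$. $\gamma(X)$ (resp. $\gamma^*(X)$) is the infimum of all $s>0$ such that there exists an $s$-dense and $2$-separated subset (resp. additive subgroup) of $X$. *)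

(* Defs.v *)
From HB Require Import structures.
From mathcomp Require Import all_boot all_order all_algebra.
From mathcomp Require Import all_classical all_reals all_analysis.
From mathcomp Require Import ring lra.

Set Implicit Arguments.
Unset Strict Implicit.
Unset Printing Implicit Defensive.

Import Order.TTheory GRing.Theory Num.Theory.
Import numFieldNormedType.Exports.

Local Open Scope classical_set_scope.
Local Open Scope card_scope.
Local Open Scope ring_scope.

(* Convexity of [powR ^~ p] with the weights a / (a + b) and b / (a + b): the
   common core of the triangle inequalities of [lp] and of [lsum]. *)
Lemma powR_add_le (R : realType) (p a b u v : R) : 1 <= p -> 0 < a -> 0 < b ->
  0 <= u -> 0 <= v ->
  (u + v) `^ p <= (a + b) `^ p *
    (a / (a + b) * (u `^ p / a `^ p) + b / (a + b) * (v `^ p / b `^ p)).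
Proof.
move=> p1 a0 b0 u0 v0.
have p0 : 0 <= p by rewrite (le_trans _ p1).
have ab0 : 0 < a + b by rewrite addr_gt0.
have t0 : 0 <= a / (a + b) by rewrite divr_ge0 ?ltW.
have t1 : a / (a + b) <= 1 by rewrite ler_pdivrMr// mul1r lerDl ltW.
have divE (x y : R) : 0 <= x -> 0 < y -> x `^ p / y `^ p = (x / y) `^ p.
  move=> x0 y0; rewrite powRM// ?invr_ge0 ?ltW//; congr (_ * _).
  by rewrite -powR_inv1 ?powR_ge0// -powRrM mulrN1 -[y^-1]powR_inv1 ?ltW//
             -powRrM mulN1r.
have uva : 0 <= u / a by rewrite divr_ge0// ltW.
have uvb : 0 <= v / b by rewrite divr_ge0// ltW.
rewrite !divE//.
have -> : u + v = (a + b) * (a / (a + b) * (u / a) + b / (a + b) * (v / b)).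
  by field; rewrite !gt_eqF.
rewrite powRM; [|exact: ltW|by rewrite addr_ge0// mulr_ge0// divr_ge0// ltW].
rewrite ler_wpM2l ?powR_ge0//.
have tE : b / (a + b) = 1 - a / (a + b).
  by field; rewrite gt_eqF.
have := convex_powR p1 (Itv01 t0 t1).
move=> /(_ (u / a) (v / b)).
rewrite !inE /= !in_itv /= !andbT => /(_ uva uvb).
by rewrite !convRE /= tE.
Qed.

Lemma powR_minkowski2 (R : realType) (p a b u1 v1 u2 v2 : R) : 1 <= p ->
  0 < a -> 0 < b -> 0 <= u1 -> 0 <= v1 -> 0 <= u2 -> 0 <= v2 ->
  u1 `^ p + u2 `^ p = a `^ p -> v1 `^ p + v2 `^ p = b `^ p ->
  ((u1 + v1) `^ p + (u2 + v2) `^ p) `^ p^-1 <= a + b.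
Proof.
move=> p1 a0 b0 u10 v10 u20 v20 ua vb.
have p0 : 0 < p by rewrite (lt_le_trans _ p1).
have ab0 : 0 < a + b by rewrite addr_gt0.
have -> : a + b = ((a + b) `^ p) `^ p^-1.
  by rewrite -powRrM mulfV ?gt_eqF// powRr1// ltW.
rewrite ge0_ler_powR ?nnegrE ?invr_ge0 ?addr_ge0 ?powR_ge0 ?(ltW p0)//.
apply: le_trans (lerD (powR_add_le p1 a0 b0 u10 v10)
                      (powR_add_le p1 a0 b0 u20 v20)) _.
rewrite -mulrDr addrACA -!mulrDr -!mulrDl ua vb.
by rewrite !divff ?gt_eqF ?powR_gt0// !mulr1 -mulrDl divff ?gt_eqF// mulr1.
Qed.

Definition lp_sum (R : realType) (p : R) (I : choiceType) (x : I -> R) : \bar R :=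
  \esum_(i in [set: I]) (`|x i| `^ p)%:E.

Definition lp_pred (R : realType) (p : R) (I : choiceType) : {pred I -> R} :=
  mem [set x : I -> R | (lp_sum p x < +oo)%E].

Record lp (R : realType) (p : R) (p1 : 1 <= p) (I : choiceType) : Type :=
  Lp { lp_val :> I -> R; _ : lp_val \in @lp_pred R p I }.

HB.lock Definition lp_norm (R : realType) (p : R) (p1 : 1 <= p) (I : choiceType)
  (x : lp p1 I) : R := fine (lp_sum p x) `^ p^-1.

Section lp_theory.
Variables (R : realType) (p : R) (p1 : 1 <= p) (I : choiceType).

Let p_gt0 : 0 < p. Proof. exact: lt_le_trans p1. Qed.

Lemma lp_sum_ge0 (x : I -> R) : (0 <= lp_sum p x)%E.
Proof. by apply: esum_ge0 => i _; rewrite lee_fin powR_ge0. Qed.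

Lemma lp_sum_scale (c : R) (f : I -> R) : 0 <= c -> (forall i, 0 <= f i) ->
  (\esum_(i in [set: I]) (c * f i)%:E = c%:E * \esum_(i in [set: I]) (f i)%:E)%E.
Proof.
move=> c0 f0; rewrite /esum -ereal_supZl//; last first.
  by apply/set0P; exists 0%E; exists set0; rewrite ?fsbig_set0//; exact: fsets_set0.
rewrite image_comp; congr ereal_sup; apply: eq_imagel => A [finA _] /=.
by rewrite ge0_mule_fsumr// => i; rewrite lee_fin.
Qed.

Lemma lp_sumZ (a : R) (x : I -> R) :
  lp_sum p (a *: x) = ((`|a| `^ p)%:E * lp_sum p x)%E.
Proof.
rewrite -lp_sum_scale ?powR_ge0//.
by apply: eq_esum => i _; rewrite -powRM// -normrM.
Qed.

Lemma lp_sumD_le (a b : R) (x y : I -> R) : 0 < a -> 0 < b ->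
  (lp_sum p (x + y)%R <= ((a + b) `^ p)%:E *
    ((a / (a + b) / a `^ p)%:E * lp_sum p x
     + (b / (a + b) / b `^ p)%:E * lp_sum p y))%E.
Proof.
move=> a0 b0.
have ab0 : 0 < a + b by rewrite addr_gt0.
have ca : 0 <= a / (a + b) / a `^ p by rewrite !divr_ge0 ?powR_ge0 ?ltW.
have cb : 0 <= b / (a + b) / b `^ p by rewrite !divr_ge0 ?powR_ge0 ?ltW.
rewrite -!lp_sum_scale//; try by move=> i; exact: powR_ge0.
rewrite -esumD; try by move=> i _; rewrite lee_fin mulr_ge0 ?powR_ge0.
rewrite -(@lp_sum_scale _ (fun i => a / (a + b) / a `^ p * `|x i| `^ p +
    b / (a + b) / b `^ p * `|y i| `^ p)) ?powR_ge0//; last first.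
  by move=> i; rewrite addr_ge0// mulr_ge0// powR_ge0.
apply: le_esum => i _; rewrite lee_fin.
have := powR_add_le p1 a0 b0 (normr_ge0 (x i)) (normr_ge0 (y i)).
rewrite -!mulrA ![_^-1 * (_ `^ _)]mulrC; apply: le_trans.
by rewrite ge0_ler_powR ?nnegrE ?addr_ge0 ?ler_normD// ltW.
Qed.

Lemma lp_pred_submod_closed : submod_closed (@lp_pred R p I).
Proof.
have Z a x : x \in @lp_pred R p I -> a *: x \in @lp_pred R p I.
  rewrite !inE /= lp_sumZ => xoo.
  by rewrite lte_mul_pinfty// ?lee_fin ?powR_ge0.
split=> [|a x y /(Z a)].
  rewrite inE /=; have := lp_sumZ 0 0; rewrite scale0r normr0.
  by rewrite powR0 ?gt_eqF// mul0e => ->; rewrite ltry.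
rewrite !inE /= => xoo yoo.
apply: le_lt_trans (lp_sumD_le _ _ ltr01 ltr01) _.
rewrite lte_mul_pinfty// ?lee_fin ?powR_ge0//.
have c0 : 0 <= 1 / (1 + 1) / 1 `^ p :> R by rewrite !divr_ge0 ?powR_ge0.
by rewrite lte_add_pinfty// lte_mul_pinfty.
Qed.

HB.instance Definition _ :=
  GRing.isSubmodClosed.Build R (I -> R) (@lp_pred R p I) lp_pred_submod_closed.

HB.instance Definition _ := [isSub for @lp_val R p p1 I].
HB.instance Definition _ := [Choice of lp p1 I by <:].
HB.instance Definition _ := [SubChoice_isSubLmodule of lp p1 I by <:].

Lemma lp_norm_ge0 (x : lp p1 I) : 0 <= lp_norm x.
Proof. by rewrite unlock powR_ge0. Qed.

Lemma lp_sum_fin (x : lp p1 I) : lp_sum p x \is a fin_num.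
Proof.
by rewrite ge0_fin_numE ?lp_sum_ge0//; have := valP x; rewrite inE.
Qed.

Lemma lp_sumE (x : lp p1 I) : lp_sum p x = (lp_norm x `^ p)%:E.
Proof.
rewrite unlock -powRrM mulVf ?gt_eqF// powRr1 ?fine_ge0 ?lp_sum_ge0//.
by rewrite fineK ?lp_sum_fin.
Qed.

Lemma lp_norm_le (x : lp p1 I) (c : R) :
  0 <= c -> (lp_sum p x <= (c `^ p)%:E)%E -> lp_norm x <= c.
Proof.
move=> c0; rewrite lp_sumE lee_fin; apply: contra_le => /gt0_ltr_powR.
by apply; rewrite ?nnegrE// lp_norm_ge0.
Qed.

Lemma lp_norm_eq0 (x : lp p1 I) : lp_norm x = 0 -> x = 0.
Proof.
move=> x0; have := lp_sumE x; rewrite x0 powR0 ?gt_eqF// => s0.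
apply/val_inj/funext => i /=; apply/normr0_eq0/(@powR_eq0_eq0 _ _ p).
apply/eqP; rewrite eq_le powR_ge0 andbT -lee_fin -s0.
apply: esum_ge; exists [set i]; first by split.
by rewrite fsbig_set1.
Qed.

Lemma lp_normZ (a : R) (x : lp p1 I) : lp_norm (a *: x) = `|a| * lp_norm x.
Proof.
rewrite unlock lp_sumZ fineM ?lp_sum_fin//= powRM ?powR_ge0 ?fine_ge0 ?lp_sum_ge0//.
by rewrite -powRrM mulfV ?gt_eqF// powRr1.
Qed.

Lemma lp_normD_pos (x y : lp p1 I) (a b : R) : 0 < a -> 0 < b ->
  lp_sum p x = (a `^ p)%:E -> lp_sum p y = (b `^ p)%:E ->
  lp_norm (x + y) <= a + b.
Proof.
move=> a0 b0 xa yb; have ab0 : 0 < a + b by rewrite addr_gt0.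
apply: lp_norm_le; first exact: ltW.
apply: le_trans (lp_sumD_le _ _ a0 b0) _.
rewrite xa yb -!EFinM lee_fin -!mulrA.
rewrite !mulVf ?gt_eqF ?powR_gt0// !mulr1.
by rewrite -mulrDl mulfV ?gt_eqF// mulr1.
Qed.

Lemma lp_normD (x y : lp p1 I) : lp_norm (x + y) <= lp_norm x + lp_norm y.
Proof.
have [/eqP/lp_norm_eq0 ->|x0] := boolP (lp_norm x == 0).
  by rewrite add0r lerDr lp_norm_ge0.
have [/eqP/lp_norm_eq0 ->|y0] := boolP (lp_norm y == 0).
  by rewrite addr0 lerDl lp_norm_ge0.
by apply: lp_normD_pos (lp_sumE x) (lp_sumE y); rewrite lt_def ?x0 ?y0 lp_norm_ge0.
Qed.

HB.instance Definition _ := Lmodule_isNormed.Build R (lp p1 I)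
  lp_normD lp_normZ lp_norm_eq0.

Lemma lp_normrE (x : lp p1 I) :
  `|x| = fine (\esum_(i in [set: I]) (`|x i| `^ p)%:E) `^ p^-1.
Proof. by rewrite -[LHS]/(lp_norm x) unlock. Qed.

End lp_theory.

(* The maximum is for r = +oo; [lsum] excludes r = -oo. *)
HB.lock Definition lsum_norm (R : realType) (r : \bar R) (X Y : normedModType R)
    (z : X * Y) : R :=
  if r is r'%:E then (`|z.1| `^ r' + `|z.2| `^ r') `^ r'^-1
  else Num.max `|z.1| `|z.2|.

(* An alias of [X * Y], which already carries the max norm. *)
Definition lsum (R : realType) (r : \bar R) (r1 : (1 <= r)%E)
  (X Y : normedModType R) : Type := (X * Y)%type.

Section lsum_theory.
Variables (R : realType) (r : \bar R) (r1 : (1 <= r)%E) (X Y : normedModType R).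

Lemma lsum_norm_ge0 (z : X * Y) : 0 <= lsum_norm r z.
Proof.
rewrite unlock; case: r => [s| |]; first exact: powR_ge0.
  by rewrite le_max normr_ge0.
by rewrite le_max normr_ge0.
Qed.

Lemma lsum_norm_eq0 (z : X * Y) : lsum_norm r z = 0 -> z = 0.
Proof.
have max0 (x : X) (y : Y) : Num.max `|x| `|y| = 0 -> (x, y) = 0.
  move=> xy0; have : `|x| <= 0 /\ `|y| <= 0.
    by rewrite -xy0 !le_max !lexx orbT.
  by rewrite !normr_le0 => -[/eqP -> /eqP ->].
rewrite unlock; case: z => x y /=.
case: r r1 => [s s1| |]; [|by move=> _ /max0|by move=> _ /max0].
have s0 : s != 0 by move: s1; rewrite lee_fin => s1; rewrite gt_eqF// (lt_le_trans _ s1).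
move=> /powR_eq0_eq0 /eqP; rewrite paddr_eq0 ?powR_ge0//.
by move=> /andP[/eqP/powR_eq0_eq0/normr0_eq0 -> /eqP/powR_eq0_eq0/normr0_eq0 ->].
Qed.

Lemma lsum_normZ (a : R) (z : X * Y) : lsum_norm r (a *: z) = `|a| * lsum_norm r z.
Proof.
rewrite unlock; case: z => x y /=; rewrite !normrZ.
case: r r1 => [s s1| |]; [|by rewrite maxr_pMr|by rewrite maxr_pMr].
have s0 : s != 0 by move: s1; rewrite lee_fin => s1; rewrite gt_eqF// (lt_le_trans _ s1).
rewrite !powRM// -mulrDr powRM ?addr_ge0 ?powR_ge0//.
by rewrite -powRrM mulfV// powRr1.
Qed.

Lemma lsum_normD (z w : X * Y) : lsum_norm r (z + w) <= lsum_norm r z + lsum_norm r w.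
Proof.
have [/eqP/lsum_norm_eq0 ->|z0] := boolP (lsum_norm r z == 0).
  by rewrite add0r lerDr lsum_norm_ge0.
have [/eqP/lsum_norm_eq0 ->|w0] := boolP (lsum_norm r w == 0).
  by rewrite addr0 lerDl lsum_norm_ge0.
have {z0} : 0 < lsum_norm r z by rewrite lt_def z0 lsum_norm_ge0.
have {w0} : 0 < lsum_norm r w by rewrite lt_def w0 lsum_norm_ge0.
have maxD : Num.max `|(z + w).1| `|(z + w).2| <=
    Num.max `|z.1| `|z.2| + Num.max `|w.1| `|w.2|.
  by rewrite ge_max !(le_trans (ler_normD _ _))// lerD// le_max lexx ?orbT.
rewrite unlock; case: r r1 => [s s1| |]//.
have {}s1 : 1 <= s by rewrite -lee_fin.
have s0 : 0 < s by rewrite (lt_le_trans _ s1).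
have powK (c : R) : 0 <= c -> c = (c `^ s^-1) `^ s.
  by move=> c0; rewrite -powRrM mulVf ?gt_eqF// powRr1.
move=> b0 a0.
apply: le_trans (powR_minkowski2 s1 a0 b0 (normr_ge0 z.1) (normr_ge0 w.1)
  (normr_ge0 z.2) (normr_ge0 w.2) (powK _ _) (powK _ _)); last 2 first.
- by rewrite addr_ge0 ?powR_ge0.
- by rewrite addr_ge0 ?powR_ge0.
rewrite ge0_ler_powR ?nnegrE ?invr_ge0 ?addr_ge0 ?powR_ge0 ?(ltW s0)//.
by rewrite lerD// ge0_ler_powR ?nnegrE ?addr_ge0 ?(ltW s0)// ler_normD.
Qed.

HB.instance Definition _ := GRing.Lmodule.copy (lsum r1 X Y) (X * Y)%type.
HB.instance Definition _ := Lmodule_isNormed.Build R (lsum r1 X Y)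
  lsum_normD lsum_normZ lsum_norm_eq0.

Lemma lsum_normrE (z : lsum r1 X Y) : `|z| = lsum_norm r z.
Proof. by []. Qed.

End lsum_theory.

Lemma card_le_min (T : choiceType) (F : set (set T)) : F !=set0 ->
  exists2 A, F A & forall B, F B -> A #<= B.
Proof.
move=> [A0 FA0].
pose P (G : set (set T -> T)) :=
  (forall g A, G g -> F A -> A (g A)) /\
  (forall g h A, G g -> G h -> F A -> g A = h A -> g = h).
have [H HP Htot|G [[GA Ginj] Gmax]] := @Zorn_bigcup _ P.
  split=> [g A [G HG Gg] FA|g h A [G HG Gg] [G' HG' G'h] FA ghA].
    by have [h _] := HP _ HG; exact: (h g A Gg FA).
  have [GG'|G'G] := Htot _ _ HG HG'.
    by have [_ inj] := HP _ HG'; apply: (inj _ _ A) => //; exact: GG'.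
  by have [_ inj] := HP _ HG; apply: (inj _ _ A) => //; exact: G'G.
have [A FA AG] : exists2 A, F A & A `<=` (fun g => g A) @` G.
  apply: contrapT => noA.
  have {}noA A : exists a, F A -> A a /\ ~ ((fun g => g A) @` G) a.
    have [FA|nFA] := pselect (F A); last first.
      have [a _] : exists a : T, True; last by exists a.
      by apply: contrapT => noT; apply: noA; exists A0 => // a _; case: noT; exists a.
    have [a /not_implyP aP] : exists a, ~ (A a -> ((fun g => g A) @` G) a).
      by apply/existsNP => AG; apply: noA; exists A.
    by exists a.
  have [g gP] := choice noA.
  apply: (Gmax (G `|` [set g])).
    split=> [h Gh|]; first by left.
    move=> /(_ g (or_intror erefl)) Gg.
    by have [_] := gP _ FA0; apply; exists g.
  split=> [h A [Gh|->] FA|h k A [Gh|->] [Gk|->] FA].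
  - exact: (GA h A Gh FA).
  - by have [] := gP _ FA.
  - exact: (Ginj h k A Gh Gk FA).
  - by move=> hgA; have [_ []] := gP _ FA; exists h.
  - by move=> gkA; have [_ []] := gP _ FA; exists k.
  - by [].
exists A => // B FB.
apply: card_le_trans (subset_card_le AG) _.
apply: card_le_trans (card_image_le _ _) _.
have Ginj' : {in G &, injective (fun g : set T -> T => g B)}.
  by move=> g h /[!inE] Gg Gh; exact: (Ginj _ _ B).
rewrite -(card_le_eql (inj_card_eq Ginj')).
by apply: subset_card_le => _ [g Gg <-]; exact: (GA g B Gg FB).
Qed.

Section dens.
Variables (R : realType) (Y : normedModType R).

Definition lspan (A : set Y) : set Y :=
  [set y | exists (n : nat) (a : 'I_n -> R) (v : 'I_n -> Y),
    (forall i, A (v i)) /\ y = \sum_(i < n) a i *: v i].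

(* [is_dens D]: the cardinal dens(Y) is the cardinality of [D]. *)
Definition is_dens (D : set Y) : Prop :=
  dense (lspan D) /\ forall E : set Y, dense (lspan E) -> D #<= E.

Lemma is_dens_ex : exists D, is_dens D.
Proof.
have [|D spanD Dmin] := @card_le_min Y [set D | dense (lspan D)].
  exists setT => O [y Oy] _; exists y; split=> //.
  exists 1%N, (fun=> 1), (fun=> y); split=> //.
  by rewrite big_ord1 scale1r.
by exists D.
Qed.

(* dens(Y) < |K| *)
Definition dens_lt (T : Type) (K : set T) : Prop :=
  exists2 D : set Y, is_dens D & (D #<= K) && ~~ (K #<= D).

End dens.
Arguments dens_lt {R} Y {T} K.

Section gamma.
Variables (R : realType) (X : normedModType R).

Definition separated (s : R) (P : set X) : Prop :=
  forall x y, P x -> P y -> x <> y -> s <= `|x - y|.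

Definition sdense (s : R) (P : set X) : Prop :=
  forall x, exists2 u, P u & `|x - u| <= s.

(* Infima are taken in [\bar R], so that the infimum of the empty set is +oo. *)
Definition gamma : \bar R :=
  ereal_inf [set s%:E | s in [set s : R | 0 < s /\
    exists P : set X, sdense s P /\ separated 2 P]].

Definition gamma_star : \bar R :=
  ereal_inf [set s%:E | s in [set s : R | 0 < s /\
    exists P : set X, [/\ zmod_closed (mem P), sdense s P & separated 2 P]]].

End gamma.
Arguments gamma {R} X.
Arguments gamma_star {R} X.

(* Main.v *)
Require Import Defs.
From HB Require Import structures.
From mathcomp Require Import all_boot all_order all_algebra.
From mathcomp Require Import all_classical all_reals all_analysis.
From mathcomp Require Import ring lra.
Import Order.TTheory GRing.Theory Num.Theory.
Import numFieldNormedType.Exports.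
Local Open Scope classical_set_scope.
Local Open Scope card_scope.
Local Open Scope ring_scope.
Set Implicit Arguments.
Unset Strict Implicit.
Unset Printing Implicit Defensive.

(** Write X for the sum of l_p(I) and Y, and put t(q) = 2 / 2^(1/q).

    Lower bound t(p), for every r. Let P be s-dense and 2-separated in X, and
    let Q be the points of P whose Y-component has norm at most s. The
    l_p-components of the points of Q are s-dense in l_p(I), because P
    approximates the points (a, 0). Choose a whose distance to them is nearly
    the largest possible. If only few points of Q had their l_p-component near
    a, then some coordinate i would be almost zero in all the differences, and
    moving a along the i-th unit vector would increase its distance to all of
    them at once, by the formula |z + c e_i|^p = |z|^p + |c|^p for z_i = 0.
    Hence many points of Q are near a ([crowded_point]), where few means:
    covered by finite sets indexed by a set to which |I| does not inject. As
    dens(Y) < |I|, the ball of radius s of Y has an epsilon-net that small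
    ([dens_lt_net]), so infinitely many of these points have
    Y-components within epsilon of one another, and their l_p-components are
    then almost 2-separated. But any infinite subset of a ball of radius rho in
    l_p(I) has two points at distance at most about 2^(1/p) rho
    ([lp_infinite_close]); so 2 <= 2^(1/p) s.

    Upper bounds. Let t = t(max p r). Fix a dense family of points x_w with
    finitely supported l_p-components, indexed by a set of cardinality at most
    |I|, and attach to w its own coordinate i_w, outside the support of x_w.
    Let d_w = x_w + t e_(i_w), which is at distance t from x_w, and
    let G be generated by those d_w for which x_w is not already within t of
    the group built so far. The family is graded in such a way that the
    coordinates used on a level are not seen by lower levels. So on the top
    level of an element of G one reads off the coefficients: two nonzero ones,
    or one of absolute value at least 2, give norm at least 2 outright, and
    h + d_w, or its opposite, has norm at least 2 because |h + x_w| >= t and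
    the fresh coordinate adds t ([greedy_lattice], [lsum_fresh_ge]). For r
    infinite one takes the product of a lattice of l_p(I), built in the same
    way, with a lattice of Y ([gamma_star_lsum_pinfty]).

    Counting the nets and the dense families requires |T x T| <= |T| for
    infinite T ([card_le_square]). *)

(** * Cardinal arithmetic *)

Lemma card_le_ex T (U : pointedType) (A : set T) (B : set U) :
  A #<= B <-> exists2 f : T -> U, set_fun A B f & set_inj A f.
Proof.
split=> [/pcard_leP/injfunPex //|AB].
by apply/pcard_leP/injfunPex.
Qed.

Lemma card_leX T (U : pointedType) T' (U' : pointedType) (A : set T) (B : set U)
    (A' : set T') (B' : set U') :
  A #<= B -> A' #<= B' -> A `*` A' #<= B `*` B'.
Proof.
move=> /card_le_ex[f fAB fi] /card_le_ex[g gAB gi]; apply/card_le_ex.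
exists (fun z => (f z.1, g z.2)) => [[a b] [/= /fAB ? /gAB ?] //|].
move=> [a b] [a' b'] /[!inE] -[/= Aa Ab] [/= Aa' Ab'] [ff gg].
by congr (_, _); [apply: fi|apply: gi]; rewrite ?inE.
Qed.

(** Two distinct elements of [C] serve as tags that keep the images of [A] and
    [B] apart inside [C `*` C]. *)
Lemma card_leU T (U : pointedType) (A B : set T) (C : set U) :
  infinite_set C -> C `*` C #<= C -> A #<= C -> B #<= C -> A `|` B #<= C.
Proof.
move=> Cinf /card_le_ex[h hC hi] /card_le_ex[f fA fi] /card_le_ex[g gB gi].
have [c0 Cc0] := infinite_setN0 Cinf.
have [c1 [Cc1 c10]] : (C `\ c0) !=set0.
  by apply/infinite_setN0/infinite_setD.
apply/card_le_ex.
exists (fun x => if x \in A then h (c0, f x) else h (c1, g x)) => [x xAB|].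
  case: ifPn => [/[!inE] Ax|]; first by apply: hC; split=> //=; exact: fA.
  rewrite notin_setE => nA; case: xAB => // Bx.
  by apply: hC; split=> //=; exact: gB.
move=> x y /[!inE] xAB yAB.
have CA z : z \in A -> (C `*` C) (c0, f z).
  by rewrite inE => Az; split=> //=; exact: fA.
have CB z : (A `|` B) z -> z \notin A -> (C `*` C) (c1, g z).
  by rewrite notin_setE => -[//|Bz] _; split=> //=; exact: gB.
have BB z : (A `|` B) z -> z \notin A -> z \in B.
  by rewrite notin_setE inE => -[].
case: ifPn => xA; case: ifPn => yA /hi; rewrite ?inE.
- by move=> /(_ (CA _ xA) (CA _ yA)) [/fi]; exact.
- by move=> /(_ (CA _ xA) (CB _ yAB yA)) [/esym].
- by move=> /(_ (CB _ xAB xA) (CA _ yA)) [].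
- move=> /(_ (CB _ xAB xA) (CB _ yAB yA)) [/gi]; apply; exact: BB.
Qed.

Lemma card_le_total (T : choiceType) (A B : set T) : A #<= B \/ B #<= A.
Proof.
have [|_ [->|->] m] := @card_le_min T [set A; B]; first by exists A; left.
- by left; apply: m; right.
- by right; apply: m; left.
Qed.

(** The proof that an infinite type has as many pairs as elements applies Zorn's
    lemma to injections [A * A -> A], [A] a subset, ordered by extension. They
    are encoded by their graphs, so that the extension order is inclusion; the
    subset is recovered from the diagonal of the graph. *)
Section infinite_square.
Variable T : pointedType.

Let dg (G : set (T * T * T)) := [set x | exists z, G ((x, x), z)].

Let pairing (G : set (T * T * T)) := [/\
  forall a b c, G ((a, b), c) -> [/\ dg G a, dg G b & dg G c],
  forall a b, dg G a -> dg G b -> exists c, G ((a, b), c)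
  & forall u v c d, G (u, c) -> G (v, d) -> u = v <-> c = d].

Let pairing_bigcup (F : set (set (T * T * T))) : F `<=` pairing ->
  total_on F subset -> pairing (\bigcup_(X in F) X).
Proof.
move=> FP Ftot.
have dgS G x : F G -> dg G x -> dg (\bigcup_(X in F) X) x.
  by move=> FG [z Gz]; exists z, G.
have two G G' : F G -> F G' -> exists2 H, F H & G `<=` H /\ G' `<=` H.
  by move=> FG FG'; have [?|?] := Ftot _ _ FG FG'; [exists G'|exists G]; do ?split.
split=> [a b c [G FG Gabc]|a b [z [G FG Gz]] [z' [G' FG' Gz']]|u v c d].
- by have [/(_ _ _ _ Gabc) [? ? ?] _ _] := FP _ FG; split; apply: (dgS G).
- have [H FH [GH GH']] := two _ _ FG FG'.
  have [_ HP _] := FP _ FH.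
  have [|| c Hc] := HP a b; first by exists z; exact: GH.
    by exists z'; exact: GH'.
  by exists c, H.
- move=> [G FG Gu] [G' FG' Gv]; have [H FH [GH GH']] := two _ _ FG FG'.
  by have [_ _] := FP _ FH; apply; [exact: GH|exact: GH'].
Qed.

(* A maximal pairing on A admits no nonempty set A' outside A into which the
   square of the union of A and A' embeds: sending the new pairs to A' would
   extend the pairing. *)
Let pairing_maximal : exists G, pairing G /\ forall A' : set T,
  A' `<=` ~` dg G -> A' !=set0 ->
  ~ ((dg G `|` A') `*` (dg G `|` A') #<= A').
Proof.
have [G [PG Gmax]] := Zorn_bigcup pairing_bigcup.
exists G; split=> // A' A'A [a0 A'a0] /card_le_ex[g gA' gi].
have [G1 G2 G3] := PG.
set A := dg G in A'A g gA' gi G1 G2.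
pose G' := G `|` [set u | [/\ (A `|` A') u.1.1, (A `|` A') u.1.2,
  ~ (A u.1.1 /\ A u.1.2) & u.2 = g u.1]].
have dgG' : dg G' = A `|` A'.
  apply/seteqP; split=> [x [z [Gz|[]]]//|x [[z Gz]|A'x]].
    by left; exists z.
    by exists z; left.
  exists (g (x, x)); right; split=> //=; try by right.
  by move=> [/A'A].
apply: (Gmax G').
  split=> [|GG']; first by left.
  have : G' ((a0, a0), g (a0, a0)).
    by right; split=> //=; try (by right); move=> [/A'A].
  by move=> /GG'/G1[/A'A].
split; rewrite ?dgG'.
- move=> a b c [/G1[? ? ?]|[/= ? ? _ ->]]; first by split; left.
  by split=> //; right; apply: gA'.
- move=> a b Aa Ab; have [[Aa' Ab']|nAab] := pselect (A a /\ A b).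
    by have [c Gc] := G2 _ _ Aa' Ab'; exists c; left.
  by exists (g (a, b)); right.
- have mix u v c d : G (u, c) -> ((A `|` A') v.1 /\ (A `|` A') v.2) ->
    ~ (A v.1 /\ A v.2) -> d = g v -> u = v <-> c = d.
    move=> /[dup] Gu; case: u Gu => a b Gu /G1[Aa Ab Ac] Av nAv dE.
    split=> [uv|cd]; first by case: nAv; rewrite -uv.
    have A'gv : A' (g v) by apply: gA'.
    by have := A'A _ A'gv; rewrite -dE -cd.
  move=> u v c d [Gu|[/= u1 u2 nu cE]] [Gv|[/= v1 v2 nv dE]].
  + exact: G3 Gu Gv.
  + exact: mix.
  + by have [mx my] := mix _ _ _ _ Gv (conj u1 u2) nu cE; split=> /esym; [move/mx|move/my].
  + rewrite cE dE; split=> [->//|/gi]; apply; rewrite inE; by split.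
Qed.

Lemma card_le_square : infinite_set [set: T] ->
  [set: T] `*` [set: T] #<= [set: T].
Proof.
move=> Tinf; have [G [[G1 G2 G3] Gmax]] := pairing_maximal.
set A := dg G in G1 G2 Gmax.
have AA : A `*` A #<= A.
  have /choice[f fP] : forall u : T * T, exists c, (A `*` A) u -> G (u, c).
    move=> [a b]; have [[Aa Ab]|?] := pselect ((A `*` A) (a, b)).
      by have [c] := G2 _ _ Aa Ab; exists c.
    by exists point.
  apply/card_le_ex; exists f => [[a b] /fP/G1[]//|u v /[!inE] /fP Gu /fP Gv].
  by rewrite (G3 _ _ _ _ Gu Gv).
(* A is infinite, otherwise a countable set outside A gives an extension. *)
have [Afin|Ainf] := pselect (finite_set A).
  have cofA : infinite_set (~` A).
    by have := infinite_setD Tinf Afin; rewrite setTD.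
  have [C0 CT] : exists2 C, C `<=` ~` A & C #= [set: nat].
    have /infiniteP/card_le_ex[f fA fi] := cofA.
    exists (f @` setT); first by move=> _ [n _ <-]; exact: fA.
    exact: inj_card_eq.
  move=> CA.
  exfalso; apply: (Gmax C0) => //.
    by apply: infinite_setN0; rewrite (eq_finite_set CA); exact: infinite_nat.
  have nat2 : [set: nat] `*` [set: nat] #<= [set: nat].
    by rewrite setXTT; have /card_eqPle[] := card_nat2.
  have AC : A `|` C0 #<= [set: nat].
    apply: card_leU => //; first exact: infinite_nat.
    - exact: finite_set_countable.
    - by have /card_eqPle[] := CA.
  apply: card_le_trans (card_leX AC AC) _.
  apply: card_le_trans nat2 _.
  by have /card_eqPle[] := CA.
(* The complement of A has no copy of A, so A has the cardinality of T. *)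
have [AcA|Ac] := card_le_total A (~` A).
  move/card_le_ex: AcA => [f fA fi]; exfalso.
  have fAE : f @` A #= A := inj_card_eq fi.
  have /card_eqPle[fA1 fA2] := fAE.
  apply: (Gmax (f @` A)) => [_ [a /fA Aa <-]//||].
    by apply: infinite_setN0; rewrite (eq_finite_set fAE).
  have AC : A `|` f @` A #<= A by apply: card_leU.
  apply: card_le_trans (card_leX AC AC) _.
  exact: card_le_trans fA2.
have TA : [set: T] #<= A by rewrite -(setUv A); apply: card_leU.
apply: card_le_trans (card_leX TA TA) _.
by apply: card_le_trans AA _; apply: subset_card_le.
Qed.

End infinite_square.

(** A list is coded by its length and a nested pairing of its entries; the length
    is needed because the default value ending the nesting may also be a code. *)
Lemma card_le_seq_rat (T : Type) : infinite_set [set: T] ->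
  [set: seq (rat * T)] #<= [set: T].
Proof.
elim/Ppointed: T => T Tinf.
  by exfalso; apply: Tinf; rewrite emptyE.
have /card_le_ex[g _ gi] := card_le_square Tinf.
have {}gi : injective g by move=> u v; apply: gi; rewrite inE; split.
have /infiniteP/card_le_ex[h _ hi] := Tinf.
have {}hi : injective h by move=> u v; apply: hi; rewrite inE.
pose fold := foldr (fun (z : rat * T) c => g (g (h (pickle z.1), z.2), c)) point.
apply/card_le_ex; exists (fun s => g (h (size s), fold s)) => // s1 s2 _ _.
move=> /gi[/hi]; elim: s1 s2 => [|[q x] s1 IH] [|[r y] s2] //= [/IH {}IH].
by move=> /gi[/gi[/hi/(pcan_inj pickleK) -> ->] /IH ->].
Qed.

(** A point of the union is determined by a set [F t] containing it and its
    rank in the enumeration of that finite set. *)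
Lemma card_le_bigcup_finite (T : Type) (U : choiceType) (F : T -> set U) :
  infinite_set [set: T] -> (forall t, finite_set (F t)) ->
  \bigcup_t F t #<= [set: T].
Proof.
elim/Ppointed: T => T in F *; first by move=> + _; rewrite emptyE.
move=> Tinf Ffin.
have /card_le_ex[g _ gi] := card_le_square Tinf.
have /infiniteP/card_le_ex[h _ hi] := Tinf.
have /choice[t tP] : forall x, exists t, (\bigcup_t F t) x -> F t x.
  move=> x; have [[t _ Ftx]|?] := pselect ((\bigcup_t F t) x); first by exists t.
  by exists point.
apply/card_le_ex.
exists (fun x => g (t x, h (index x (finmap.enum_fset (fset_set (F (t x))))))) => // x y /[!inE].
move=> /tP Fx /tP Fy /gi; rewrite !inE => /(_ (conj I I) (conj I I)) [txy].
move=> /hi; rewrite !inE => /(_ I I); rewrite -txy => ixy.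
have mem z : F (t x) z -> z \in finmap.enum_fset (fset_set (F (t x))).
  by move=> Fz; have := in_fset_set (Ffin (t x)) z; rewrite mem_set.
have my : F (t x) y by rewrite txy.
exact: (seq.index_inj x (mem _ Fx) (mem _ my) ixy).
Qed.

(** This is how the hypothesis that a cardinal is smaller than that of the index
    set gets used: a coordinate can be found outside few finite sets. The
    condition on [N] covers finite [N] and infinite [N] of smaller cardinality. *)
Lemma bigcup_finite_avoid (T : Type) (U : choiceType) (N : set T) (F : T -> set U) :
  infinite_set [set: U] -> ~ ([set: U] #<= N) ->
  (forall t, N t -> finite_set (F t)) ->
  exists i, forall t, N t -> ~ F t i.
Proof.
move=> Uinf UN Ffin; apply: contrapT => noi.
have {}noi : [set: U] = \bigcup_(t in N) F t.
  apply/seteqP; split=> // i _; apply: contrapT => nFi; apply: noi.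
  by exists i => t Nt Fti; apply: nFi; exists t.
have [Nfin|Ninf] := pselect (finite_set N).
  by apply: Uinf; rewrite noi; exact: bigcup_finite.
apply: UN; have /card_eqPle[NN _] := card_setT N.
apply: card_le_trans NN; rewrite noi.
have -> : \bigcup_(t in N) F t = \bigcup_(t : N) F (val t).
  apply/seteqP; split=> [i [t Nt Fti]|i [[t Nt] _ Fti]].
    by exists (exist _ t (mem_set Nt)).
  by exists t => //; exact: set_mem.
apply: card_le_bigcup_finite => [|[t Nt]]; last exact/Ffin/set_mem.
by rewrite (eq_finite_set (card_setT N)).
Qed.

Lemma card_le_seq_rat_mono (T U : Type) : [set: T] #<= [set: U] ->
  [set: seq (rat * T)] #<= [set: seq (rat * U)].
Proof.
move=> TU; have [f fi] : exists f : T -> U, injective f.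
  elim/Ppointed: U => U in TU *.
    move: TU; rewrite [X in _ #<= X -> _]emptyE => /card_le0P T0.
    have noT (x : T) : False by have : [set: T] x by []; rewrite T0.
    by exists (fun x => match noT x with end) => x; case: (noT x).
  have /card_le_ex[f _ fi] := TU.
  by exists f => x y; apply: fi; rewrite inE.
have /injfunPex[g] : exists2 g : seq (rat * T) -> seq (rat * U),
    set_fun setT setT g & set_inj setT g; last exact: inj_card_le.
exists (map (fun z => (z.1, f z.2))) => // s s' _ _.
by apply: inj_map => -[q x] [q' x'] [-> /fi ->].
Qed.

Lemma card_le_setX_self (T T' U : Type) : infinite_set [set: U] ->
  [set: T] #<= [set: U] -> [set: T'] #<= [set: U] -> [set: T * T'] #<= [set: U].
Proof.
elim/Ppointed: U => U Uinf; first by exfalso; apply: Uinf; rewrite emptyE.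
move=> TU T'U; rewrite -setXTT; apply: card_le_trans (card_leX TU T'U) _.
exact: card_le_square.
Qed.

Lemma infinite_inj_nat (T U : Type) : infinite_set [set: U] ->
  [set: T] #<= [set: U] -> exists f : T * nat -> U, injective f.
Proof.
move=> Uinf TU; have := card_le_setX_self Uinf TU ((infiniteP _).1 Uinf).
elim/Ppointed: U => U in TU Uinf *; first by exfalso; apply: Uinf; rewrite emptyE.
by move=> /card_le_ex[f _ fi]; exists f => x y; apply: fi; rewrite inE.
Qed.

(** * Rational combinations, spans of finitely many vectors, and nets *)

Section spans.
Variables (R : realType) (V : normedModType R).
Implicit Types (u v w y : V) (s : seq V) (A : set V).

Lemma dense_norm A v (e : R) : dense A -> 0 < e -> exists2 w, A w & `|v - w| < e.
Proof.
move=> dA e0; have [||w [bw Aw]] := dA (ball v e); first by exists v; exact: ballxx.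
  exact: ball_open.
by exists w; rewrite // -ball_normE in bw.
Qed.

Lemma dense_of_norm A :
  (forall v (e : R), 0 < e -> exists2 w, A w & `|v - w| < e) -> dense A.
Proof.
move=> hA O [v Ov] oO.
have /nbhs_ballP[e e0 eO] : nbhs v O by exact: open_nbhs_nbhs.
have [w Aw vw] := hA v e e0; exists w; split=> //; apply: eO.
by rewrite -ball_normE.
Qed.

Definition rat_comb (T : Type) (v : T -> V) (l : seq (rat * T)) : V :=
  \sum_(z <- l) ratr z.1 *: v z.2.

Lemma dense_rat_comb (T : Type) (v : T -> V) :
  dense (lspan (range v)) ->
  forall x (e : R), 0 < e -> exists l, `|x - rat_comb v l| < e.
Proof.
move=> dv x e e0.
pose adh y := forall e : R, 0 < e -> exists l, `|y - rat_comb v l| < e.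
have adhD y y' : adh y -> adh y' -> adh (y + y').
  move=> hy hy' d d0; have d20 : 0 < d / 2 by rewrite divr_gt0.
  have [l yl] := hy _ d20; have [l' yl'] := hy' _ d20.
  exists (l ++ l'); rewrite /rat_comb big_cat/= opprD addrACA.
  by rewrite (le_lt_trans (ler_normD _ _))// [ltRHS]splitr ltrD.
have adhZ a t : adh (a *: v t).
  move=> d d0; have v0 : 0 < `|v t| + 1 by rewrite ltr_wpDl.
  have dv0 : 0 < d / (`|v t| + 1) by rewrite divr_gt0.
  have [|q] := @rat_in_itvoo R (a - d / (`|v t| + 1)) (a + d / (`|v t| + 1)).
    by rewrite ltrBlDr -addrA ltrDl addr_gt0.
  rewrite in_itv/= => qP; exists [:: (q, t)].
  rewrite /rat_comb big_seq1/= -scalerBl normrZ.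
  have : `|a - ratr q| < d / (`|v t| + 1).
    by have /andP[? ?] := qP; rewrite ltr_norml; apply/andP; split; lra.
  rewrite ltr_pdivlMr//; apply: le_lt_trans.
  by rewrite ler_wpM2l// lerDl.
have [y [n [a [w [wv ->]]]] xy] := dense_norm x dv (divr_gt0 e0 (ltr0n R 2)).
have : adh (\sum_(i < n) a i *: w i).
  elim/big_ind : _ => //.
    by move=> d d0; exists [::]; rewrite /rat_comb big_nil subr0 normr0.
  by move=> i _; have [t _ <-] := wv i; exact: adhZ.
move=> /(_ _ (divr_gt0 e0 (ltr0n R 2)))[l yl]; exists l.
rewrite -(subrK (\sum_(i < n) a i *: w i) x) -addrA.
by rewrite (le_lt_trans (ler_normD _ _))// [ltRHS]splitr ltrD.
Qed.

(** Rational combinations of the elements of [D] itself, as a family indexed by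
    lists over the subtype [D], whose cardinality is under control. *)
Lemma dense_rat_comb_set (D : set V) : dense (lspan D) ->
  forall x (e : R), 0 < e -> exists l, `|x - rat_comb (val : D -> V) l| < e.
Proof.
move=> dD; apply: dense_rat_comb; have -> // : range (val : D -> V) = D.
apply/seteqP; split=> [_ [[x Dx] _ <-]|x Dx]; first exact: set_mem.
by exists (exist _ x (mem_set Dx)).
Qed.

(** The linear span of a list, by recursion on the list: this is the form on which
    total boundedness is proved one vector at a time. *)
Fixpoint lin_span s : set V :=
  if s is v :: s' then [set u | exists c : R, lin_span s' (u - c *: v)]
  else [set 0].

Lemma lin_span0 s : lin_span s 0.
Proof. by elim: s => //= v s IH; exists 0; rewrite scale0r subr0. Qed.

Lemma lin_spanDZ s (c : R) u w : lin_span s u -> lin_span s w -> lin_span s (u + c *: w).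
Proof.
elim: s u w => [u w -> ->|v s IH u w [a ua] [b wb]] /=.
  by rewrite scaler0 addr0.
exists (a + c * b); have := IH _ _ ua wb.
by rewrite scalerBr scalerA scalerDl opprD addrACA.
Qed.

Lemma lin_spanD s u w : lin_span s u -> lin_span s w -> lin_span s (u + w).
Proof. by move=> su /(lin_spanDZ 1 su); rewrite scale1r. Qed.

Lemma lin_spanZ s (c : R) u : lin_span s u -> lin_span s (c *: u).
Proof. by move=> /(lin_spanDZ c (lin_span0 s)); rewrite add0r. Qed.

Lemma lin_span_mem s v : v \in s -> lin_span s v.
Proof.
elim: s => //= w s IH; rewrite inE => /orP[/eqP ->|/IH sv].
  by exists 1; rewrite scale1r subrr; exact: lin_span0.
by exists 0; rewrite scale0r subr0.
Qed.

Lemma lspan_lin_span s : lspan [set` s] `<=` lin_span s.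
Proof.
move=> _ [n [a [v [vs ->]]]].
elim/big_ind : _ => [|u w|i _]; [exact: lin_span0|exact: lin_spanD|].
by apply: lin_spanZ; apply: lin_span_mem; exact: vs.
Qed.

Lemma lin_span_lspan s A : [set` s] `<=` A -> lin_span s `<=` lspan A.
Proof.
elim: s => [_ _ ->|v s IH vsA u [c]] /=.
  by exists 0%N, (fun=> 0), (fun=> 0); split=> [[]//|]; rewrite big_ord0.
have /IH {}IH : [set` s] `<=` A.
  by move=> w sw; apply: vsA; rewrite /= inE sw orbT.
move=> /IH[n [a [w [wA uE]]]].
exists n.+1, (fun i => oapp a c (unlift ord0 i)),
  (fun i => oapp w v (unlift ord0 i)); split=> [i|].
  by case: unliftP => [j _|_] /=; [exact: wA|apply: vsA; rewrite /= mem_head].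
rewrite big_ord_recl unlift_none /=; under eq_bigr do rewrite liftK /=.
by rewrite -uE addrC subrK.
Qed.

End spans.

Lemma interval_net (R : realType) (M e : R) : 0 < e ->
  exists2 C : set R, finite_set C &
    forall c, `|c| <= M -> exists2 c0, C c0 & `|c - c0| <= e.
Proof.
move=> e0.
exists ((fun k : nat => k%:R * e - M) @` `I_(Num.truncn ((M + M) / e)).+1).
  exact/finite_image/finite_II.
move=> c; rewrite ler_norml => /andP[Mc cM].
have c0 : 0 <= (c + M) / e by rewrite divr_ge0 ?(ltW e0)// -lerBlDr sub0r.
have /andP[k1 k2] := truncn_itv c0.
set k := Num.truncn _ in k1 k2.
exists (k%:R * e - M).
  exists k => //=; rewrite ltnS; apply: le_truncn.
  by rewrite ler_pM2r ?invr_gt0// lerD2r.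
move: k1 k2; rewrite ler_pdivlMr// ltr_pdivrMr// -natr1 mulrDl mul1r => k1 k2.
by rewrite ler_norml; apply/andP; split; lra.
Qed.

Definition totally_bounded (R : realType) (V : normedModType R) (A : set V) :=
  forall e : R, 0 < e -> exists2 N : set V, finite_set N &
    forall u, A u -> exists2 n, N n & `|u - n| <= e.

(** Induction on the list, adding a vector v to a span S. If v is at positive
    distance d from S, then |u + c v| >= |c| d for u in S, so c stays in a
    bounded interval, which has a finite net. Otherwise v can be replaced by
    elements of S, and the net for S, at a slightly larger radius, is enough. *)
Lemma lin_span_totally_bounded (R : realType) (V : normedModType R) (s : seq V) (r : R) :
  totally_bounded (lin_span s `&` [set u | `|u| <= r]).
Proof.
elim: s r => [r e e0|v s IH r e e0].
  exists [set 0]; first exact: finite_set1.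
  by move=> _ [-> _]; exists 0; rewrite ?subrr ?normr0 ?(ltW e0).
have e20 : 0 < e / 2 by rewrite divr_gt0.
have [[d d0 dP]|nd] := pselect (exists2 d : R, 0 < d &
    forall w, lin_span s w -> d <= `|v - w|).
  pose M := r / d.
  have v0 : 0 < `|v| + 1 by rewrite ltr_wpDl.
  have [N Nfin NP] := IH (r + M * `|v|) _ e20.
  have [C Cfin CP] := interval_net M (divr_gt0 e20 v0).
  exists [set z | exists2 n, N n & exists2 c, C c & n + c *: v = z].
    have := finite_image2 (fun n c => n + c *: v) Nfin Cfin.
    by apply: sub_finite_set => z [n Nn [c Cc <-]]; exists n => //; exists c.
  move=> u [[c sc] /= ur].
  have cM : `|c| <= M.
    have [->|c0] := eqVneq c 0.
      by rewrite normr0 divr_ge0 ?(ltW d0)// (le_trans _ ur).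
    rewrite ler_pdivlMr// (le_trans _ ur)//.
    have := dP _ (lin_spanZ (- c^-1) sc).
    rewrite -(ler_pM2l (_ : 0 < `|c|)) ?normr_gt0// => /le_trans; apply.
    rewrite -normrZ scalerBr scalerA mulrN mulfV// scaleN1r opprK.
    by rewrite addrC subrK.
  have [n Nn un] : exists2 n, N n & `|u - c *: v - n| <= e / 2.
    apply: NP; split=> //=; rewrite (le_trans (ler_normB _ _))// normrZ.
    by rewrite lerD// ler_wpM2r.
  have [c0 Cc0 cc0] := CP _ cM.
  exists (n + c0 *: v); first by exists n => //; exists c0.
  have -> : u - (n + c0 *: v) = (u - c *: v - n) + (c - c0) *: v.
    rewrite scalerBl opprD !addrA; congr (_ - _).
    by rewrite addrAC subrK.
  rewrite (le_trans (ler_normD _ _))// [leRHS]splitr lerD// normrZ.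
  move: cc0; rewrite ler_pdivlMr//; apply: le_trans.
  by rewrite ler_wpM2l// lerDl.
have {}nd d : 0 < d -> exists2 w, lin_span s w & `|v - w| < d.
  move=> d0; apply: contrapT => nw; apply: nd; exists d => // w sw.
  by rewrite leNgt; apply/negP => ?; apply: nw; exists w.
have [N Nfin NP] := IH (r + e / 2) _ e20.
exists N => // u [[c sc] /= ur].
have c0 : 0 < `|c| + 1 by rewrite ltr_wpDl.
have [w sw vw] := nd _ (divr_gt0 e20 c0).
have uw : `|u - (u - c *: v + c *: w)| <= e / 2.
  rewrite opprD opprB addrA addrCA subrr addr0 -scalerBr normrZ.
  move: vw; rewrite ltr_pdivlMr// => /ltW; apply: le_trans.
  by rewrite mulrC ler_wpM2l// lerDl.
have [n Nn un] : exists2 n, N n & `|u - c *: v + c *: w - n| <= e / 2.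
  apply: NP; split=> /=; first exact: lin_spanDZ.
  rewrite -[_ + _](subrK u) (le_trans (ler_normD _ _))// addrC lerD//.
  by rewrite distrC.
exists n => //; rewrite -(subrK (u - c *: v + c *: w) u) -addrA.
by rewrite (le_trans (ler_normD _ _))// [leRHS]splitr lerD.
Qed.

Section nets.
Variables (R : realType) (Y : normedModType R).

(** Let [D] realise dens(Y). If [D] is finite, the ball is almost contained in a
    finite-dimensional one and has a finite net; if [D] is infinite, the rational
    combinations of [D] are dense and as numerous as [D]. *)
Lemma dens_lt_net (K : choiceType) (r e : R) : infinite_set [set: K] ->
  dens_lt Y [set: K] -> 0 < e ->
  exists2 N : set Y, ~ ([set: K] #<= N) &
    forall y, `|y| <= r -> exists2 n, N n & `|y - n| <= e.
Proof.
move=> Kinf [D [dD _] /andP[DK /negP KD]] e0.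
have e20 : 0 < e / 2 by rewrite divr_gt0.
have [Dfin|Dinf] := pselect (finite_set D).
  have [s Ds] := (finite_seqP _).1 Dfin.
  have [N Nfin NP] := @lin_span_totally_bounded _ _ s (r + e / 2) _ e20.
  exists N; first by move=> /card_le_finite/(_ Nfin).
  move=> y yr; have [w Dw yw] := dense_norm y dD e20.
  have [n Nn wn] : exists2 n, N n & `|w - n| <= e / 2.
    apply: NP; split=> /=; first by apply: lspan_lin_span; rewrite -Ds.
    rewrite -[w](subrK y) (le_trans (ler_normD _ _))// addrC lerD//.
    by rewrite distrC ltW.
  exists n => //; rewrite -(subrK w y) -addrA.
  by rewrite (le_trans (ler_normD _ _))// [leRHS]splitr lerD// ltW.
exists (range (rat_comb (val : D -> Y))).
  move=> KN; apply: KD; apply: card_le_trans KN _.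
  apply: card_le_trans (card_image_le _ _) _.
  have /card_eqPle[DD _] := card_setT D.
  apply: card_le_trans DD; apply: card_le_seq_rat.
  by rewrite (eq_finite_set (card_setT D)).
move=> y _; have [l yl] := dense_rat_comb_set dD y e0.
by exists (rat_comb val l); [exists l|exact: ltW].
Qed.

End nets.

(** * Coordinates in l_p *)

Lemma powR_le_inv (R : realType) (p a b : R) : 0 < p -> 0 <= a -> 0 <= b ->
  a `^ p <= b `^ p -> a <= b.
Proof.
move=> p0 a0 b0; apply: contra_le => ba.
by apply: gt0_ltr_powR; rewrite ?nnegrE.
Qed.

Lemma powR_le_mono (R : realType) (p a b : R) : 0 < p -> 0 <= a ->
  a <= b -> a `^ p <= b `^ p.
Proof.
move=> p0 a0 ab.
by rewrite ge0_ler_powR ?nnegrE// ?(ltW p0)// (le_trans a0).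
Qed.

Section lp_coordinates.
Variables (R : realType) (p : R) (p1 : 1 <= p) (I : choiceType).
Notation lp := (lp p1 I).
Implicit Types (x y : lp) (i j : I) (J : set I) (t : R).

Let p0 : 0 < p. Proof. exact: lt_le_trans p1. Qed.

Lemma lp_addE x y i : (x + y) i = x i + y i. Proof. by []. Qed.
Lemma lp_oppE x i : (- x) i = - x i. Proof. by []. Qed.
Lemma lp_scaleE t x i : (t *: x) i = t * x i. Proof. by []. Qed.

Lemma lp_eq x y : (forall i, x i = y i) -> x = y.
Proof. by move=> xy; apply/val_inj/funext. Qed.

Lemma lp_powE x : lp_sum p x = (`|x| `^ p)%:E.
Proof. exact: lp_sumE. Qed.

(** The source of the exponent p in the whole argument: projections onto sets of
    coordinates and steps along unit vectors change the norm by this rule. *)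
Lemma lp_powD_disjoint x y : (forall i, x i = 0 \/ y i = 0) ->
  `|x + y| `^ p = `|x| `^ p + `|y| `^ p.
Proof.
move=> xy; apply: EFin_inj; rewrite EFinD -!lp_powE /lp_sum.
rewrite -esumD; try by move=> i _; rewrite lee_fin powR_ge0.
apply: eq_esum => i _; rewrite -EFinD lp_addE.
by have [->|->] := xy i; rewrite ?add0r ?addr0 normr0 powR0 ?gt_eqF ?add0r ?addr0.
Qed.

Let restr_subproof J x :
  (fun i => if i \in J then x i else 0) \in @lp_pred R p I.
Proof.
have := valP x; rewrite !inE; apply: le_lt_trans; apply: le_esum => i _.
by rewrite lee_fin; case: ifP => // _; rewrite normr0 powR0 ?gt_eqF ?powR_ge0.
Qed.

Definition lp_restr J x : lp := Lp p1 (restr_subproof J x).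

Lemma lp_restrE J x i : lp_restr J x i = if i \in J then x i else 0.
Proof. by []. Qed.

Lemma lp_restrK J x : lp_restr J x + lp_restr (~` J) x = x.
Proof.
apply: lp_eq => i; rewrite lp_addE !lp_restrE in_setC.
by case: ifP; rewrite ?addr0 ?add0r.
Qed.

Lemma lp_restr_pow J x :
  `|x| `^ p = `|lp_restr J x| `^ p + `|lp_restr (~` J) x| `^ p.
Proof.
rewrite -{1}(lp_restrK J x) lp_powD_disjoint// => i.
by rewrite !lp_restrE in_setC; case: ifP; [right|left].
Qed.

Lemma lp_restr_le J x : `|lp_restr J x| <= `|x|.
Proof.
by apply: (powR_le_inv p0); rewrite // (lp_restr_pow J x) lerDl powR_ge0.
Qed.

Let delta_sum i : lp_sum p (fun j => (j == i)%:R : R) = 1%:E.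
Proof.
rewrite /lp_sum (_ : esum _ _ = \esum_(j in [set i]) 1%:E).
  by rewrite esum_set1 ?lee_fin ?ler01.
rewrite [RHS]esum_mkcond; apply: eq_esum => j _.
rewrite (_ : (j \in [set i]) = (j == i)); last by apply/idP/eqP; rewrite inE.
by case: eqP => _; rewrite ?normr1 ?powR1// normr0 powR0 ?gt_eqF.
Qed.

Let delta_subproof i : (fun j => (j == i)%:R : R) \in @lp_pred R p I.
Proof. by rewrite inE /= delta_sum ltry. Qed.

Definition lp_delta i : lp := Lp p1 (delta_subproof i).

Lemma lp_deltaE i j : lp_delta i j = (j == i)%:R. Proof. by []. Qed.

Lemma lp_norm_delta i : `|lp_delta i| = 1.
Proof.
have : lp_sum p (lp_delta i) = 1%:E := delta_sum i.
rewrite lp_powE => -[d1].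
by apply/le_anti/andP; split; apply: (powR_le_inv p0); rewrite // d1 powR1.
Qed.

Lemma lp_powD_delta x i t : x i = 0 ->
  `|x + t *: lp_delta i| `^ p = `|x| `^ p + `|t| `^ p.
Proof.
move=> xi; rewrite lp_powD_disjoint; first by rewrite normrZ lp_norm_delta mulr1.
move=> j; rewrite lp_scaleE lp_deltaE; case: eqP => [->|_]; first by left.
by right; rewrite mulr0.
Qed.

Lemma lp_pow_coord x i :
  `|x| `^ p = `|x - x i *: lp_delta i| `^ p + `|x i| `^ p.
Proof.
rewrite -(@lp_powD_delta _ i) ?subrK//.
by rewrite lp_addE lp_oppE lp_scaleE lp_deltaE eqxx mulr1 subrr.
Qed.

Lemma lp_coord_le x i : `|x i| <= `|x|.
Proof.
by apply: (powR_le_inv p0); rewrite // (lp_pow_coord x i) lerDr powR_ge0.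
Qed.

Lemma lp_two_coords_le x i j : i != j ->
  `|x i| `^ p + `|x j| `^ p <= `|x| `^ p.
Proof.
move=> ij; rewrite (lp_pow_coord x i) addrC lerD2r.
rewrite (lp_pow_coord (x - x i *: lp_delta i) j).
rewrite lp_addE lp_oppE lp_scaleE lp_deltaE eq_sym (negPf ij) mulr0 subr0.
by rewrite lerDr powR_ge0.
Qed.

(** The sum defining the norm is a supremum of finite sums; by additivity on
    disjoint supports, a nearly optimal finite sum leaves a small tail. *)
Lemma lp_truncate x (e : R) : 0 < e ->
  exists s : seq I, `|lp_restr (~` [set` s]) x| < e.
Proof.
move=> e0; have ep0 : 0 < e `^ p by rewrite powR_gt0.
have xfin : lp_sum p x \is a fin_num by rewrite lp_powE.
have [_ [A [Afin _] <-]] := ub_ereal_sup_adherent ep0 xfin.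
have [s As] := (finite_seqP _).1 Afin.
rewrite -/(esum _ _) -/(lp_sum _ _) lp_powE -EFinB => xA.
exists s; rewrite ltNge; apply/negP => /(powR_le_mono p0 (ltW e0)).
apply/negP; rewrite -ltNge.
have : (\sum_(i \in A) (`|x i| `^ p)%:E <= (`|lp_restr A x| `^ p)%:E)%E.
  rewrite -lp_powE; apply: esum_ge; exists A; first by split.
  apply: lee_fsum => // i Ai; rewrite lp_restrE mem_set//.
move=> /(lt_le_trans xA); rewrite lte_fin (lp_restr_pow A x) -As; lra.
Qed.

Lemma lp_finite_large x (e : R) : 0 < e -> finite_set [set i | e <= `|x i|].
Proof.
move=> /(lp_truncate x)[s xs].
apply: sub_finite_set (finite_seq s) => i /= ei; apply: contrapT => si.
have := lp_coord_le (lp_restr (~` [set` s]) x) i.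
rewrite lp_restrE ifT; last by rewrite in_setC mem_setE; apply/negP.
move=> /(le_trans ei)/le_lt_trans.
by move=> /(_ _ xs); rewrite ltxx.
Qed.

Lemma lp_restr_lin_span s x : lin_span (map lp_delta s) (lp_restr [set` s] x).
Proof.
elim: s => [|i s IH] /=.
  by apply: lp_eq => i; rewrite lp_restrE /= mem_setE.
have [si|si] := boolP (i \in s).
  exists 0; rewrite scale0r subr0 (_ : [set` i :: s] = [set` s])//.
  apply/seteqP; split=> j /=; rewrite inE; first by move=> /orP[/eqP ->|].
  by move=> ->; rewrite orbT.
exists (x i); rewrite (_ : _ - _ = lp_restr [set` s] x)//.
apply: lp_eq => j; rewrite lp_addE lp_oppE lp_scaleE lp_deltaE !lp_restrE.
rewrite !mem_setE inE; have [->|ji] := eqVneq j i.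
  by rewrite /= (negPf si) mulr1 subrr.
by rewrite /= mulr0 subr0.
Qed.

Lemma lp_dense_span : dense (lspan (range lp_delta)).
Proof.
apply: dense_of_norm => x e /(lp_truncate x)[s xs].
exists (lp_restr [set` s] x); last by rewrite -{1}(lp_restrK [set` s] x) addrAC subrr add0r.
apply: (lin_span_lspan _ (@lp_restr_lin_span s x)) => _ /mapP[i _ ->].
by exists i.
Qed.

Lemma rat_comb_delta0 (l : seq (rat * I)) i : i \notin map snd l ->
  rat_comb lp_delta l i = 0.
Proof.
elim: l => [|[q j] l IH] /=; first by rewrite /rat_comb big_nil.
rewrite inE negb_or => /andP[ij /IH {}IH].
rewrite /rat_comb big_cons -/(rat_comb _ _) lp_addE IH addr0.
by rewrite lp_scaleE lp_deltaE (negPf ij) mulr0.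
Qed.

End lp_coordinates.

(** * Close points in infinite bounded subsets of l_p *)

Lemma infinite_fiber (T U : Type) (F : set T) (N : set U) (Q : T -> U -> Prop) :
  infinite_set F -> finite_set N -> (forall u, F u -> exists2 n, N n & Q u n) ->
  exists2 n, N n & infinite_set (F `&` [set u | Q u n]).
Proof.
move=> Finf Nfin FQ; apply: contrapT => nQ; apply: Finf.
apply: (@sub_finite_set _ _ (\bigcup_(n in N) (F `&` [set u | Q u n]))).
  by move=> u Fu; have [n Nn Qun] := FQ _ Fu; exists n.
apply: bigcup_finite => // n Nn; apply: contrapT => Qinf.
by apply: nQ; exists n.
Qed.

Section close_points.
Variables (R : realType) (p : R) (p1 : 1 <= p) (I : choiceType).
Notation lp := (lp p1 I).

Let p0 : 0 < p. Proof. exact: lt_le_trans p1. Qed.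

Lemma lp_restr_restr (J J' : set I) (x : lp) :
  lp_restr J (lp_restr J' x) = lp_restr (J `&` J') x.
Proof.
apply: lp_eq => i; rewrite !lp_restrE in_setI.
by case: (i \in J) => //=; case: ifP.
Qed.

(** Take a finite set J of coordinates and an infinite subset G of F such that
    the p-th power of the norm on J is almost as large on all of G as it can be
    made on an infinite subset. By total boundedness, G may be taken to be
    almost constant on J. Choose v in G and a finite K containing J outside of
    which v is small. By maximality some other w in G has little mass on
    K minus J, so that v and w are, up to small errors, equal on J and of
    disjoint support elsewhere. *)
Lemma lp_infinite_close (F : set lp) (r e : R) : infinite_set F ->
  (forall v, F v -> `|v| <= r) -> 0 < e ->
  exists v w, [/\ F v, F w, v <> w & `|v - w| <= 2 `^ p^-1 * r + e].
Proof.
move=> Finf Fr e0; pose e1 := e / 4.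
have e10 : 0 < e1 by rewrite divr_gt0.
have e1p0 : 0 < e1 `^ p / 2 by rewrite divr_gt0// powR_gt0.
have r0 : 0 <= r.
  by have [v /Fr] := infinite_setN0 Finf; exact: le_trans.
(* c is in S if the mass on a suitable finite set of coordinates is at least c
   on an infinite subset of F. *)
pose S := [set c : R | exists s : seq I, exists G : set lp,
  [/\ G `<=` F, infinite_set G & forall v, G v -> c <= `|lp_restr [set` s] v| `^ p]].
have Ssup : has_sup S.
  split.
    by exists 0, [::], F; split=> // v _; exact: powR_ge0.
  exists (r `^ p) => c [s [G [GF Ginf Gc]]].
  have [v Gv] := infinite_setN0 Ginf.
  apply: le_trans (Gc _ Gv) _; apply: powR_le_mono => //.
  by apply: le_trans (Fr _ (GF _ Gv)); exact: lp_restr_le.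
have [c [s [G0 [G0F G0inf G0c]]] cS] := sup_adherent e1p0 Ssup.
have [N Nfin NP] := lin_span_totally_bounded (map (@lp_delta _ _ p1 I) s) r
  (divr_gt0 e10 (ltr0n R 2)).
have [n Nn Ginf] : exists2 n, N n & infinite_set
    (G0 `&` [set u : lp | `|lp_restr [set` s] u - n| <= e1 / 2]).
  apply: infinite_fiber => // u /G0F Fu; apply: NP; split=> /=.
    exact: lp_restr_lin_span.
  by apply: le_trans (Fr _ Fu); exact: lp_restr_le.
set G := _ `&` _ in Ginf.
have [v [G0v vn]] := infinite_setN0 Ginf.
have [s' vs'] := lp_truncate v e10.
pose J := [set` s]; pose K := [set` s ++ s'].
have JK : J `<=` K by move=> i; rewrite /J /K /= mem_cat => ->.
have vK : `|lp_restr (~` K) v| <= e1.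
  apply: le_trans (ltW vs').
  rewrite (_ : lp_restr _ v = lp_restr (~` K) (lp_restr (~` [set` s']) v)).
    exact: lp_restr_le.
  rewrite lp_restr_restr; congr (lp_restr _ _).
  apply/esym/setIidPl/subsetC => i; rewrite /K /= mem_cat => ->.
  by rewrite orbT.
(* Only finitely many w in G carry more mass on K than the supremum allows. *)
have bad : finite_set (G `&` [set w | sup S + e1 `^ p / 2 <= `|lp_restr K w| `^ p]).
  apply: contrapT => Binf.
  have : S (sup S + e1 `^ p / 2).
    exists (s ++ s'), (G `&` [set w | sup S + e1 `^ p / 2 <= `|lp_restr K w| `^ p]).
    by split=> // [w [[/G0F]]//|w []].
  by move=> /(sup_ubound Ssup.2); rewrite leNgt ltrDl e1p0.
have badv := conj bad (finite_set1 v); rewrite -finite_setU in badv.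
have [w [[G0w wn] nw]] := infinite_setN0 (infinite_setD Ginf badv).
have wv : v <> w by move=> vw; apply: nw; right.
have wK : `|lp_restr K w| `^ p < sup S + e1 `^ p / 2.
  by rewrite ltNge; apply/negP => wS; apply: nw; left; split.
have wJ := G0c _ G0w.
have resJ (x : lp) : lp_restr J (lp_restr K x) = lp_restr J x.
  by rewrite lp_restr_restr (setIidPl _ _).2.
have resJC (x : lp) : lp_restr (~` J) x = lp_restr (~` J) (lp_restr K x) + lp_restr (~` K) x.
  apply: lp_eq => i; rewrite lp_addE !lp_restrE !in_setC.
  case: (boolP (i \in K)) => iK; rewrite /= ?addr0 ?add0r//.
  have [iJ|_] := boolP (i \in J); last by rewrite /= add0r.
  by have := mem_set (JK _ (set_mem iJ)); rewrite (negPf iK).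
have wM : `|lp_restr (~` J) (lp_restr K w)| <= e1.
  apply: (powR_le_inv p0) => //; first exact: ltW.
  have := lp_restr_pow J (lp_restr K w); rewrite resJ => wE.
  by move: wK wJ; rewrite -/J; lra.
have far : `|lp_restr (~` J) (lp_restr K v) - lp_restr (~` K) w| <= 2 `^ p^-1 * r.
  apply: (powR_le_inv p0) => //; first by rewrite mulr_ge0 ?powR_ge0.
  rewrite lp_powD_disjoint; last first.
    move=> i; rewrite lp_oppE !lp_restrE !in_setC; case: (i \in K) => /=.
      by right; rewrite oppr0.
    by left; rewrite if_same.
  rewrite normrN powRM ?powR_ge0// -powRrM mulVf ?gt_eqF// powRr1//.
  rewrite (_ : 2 * _ = r `^ p + r `^ p); last by rewrite mulr_natl mulr2n.
  rewrite lerD// powR_le_mono//.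
    apply: le_trans (Fr _ (G0F _ G0v)).
    by apply: le_trans (lp_restr_le _ _) _; exact: lp_restr_le.
  by apply: le_trans (Fr _ (G0F _ G0w)); exact: lp_restr_le.
have near : `|lp_restr J v - lp_restr J w| <= e1.
  rewrite -(subrK n (lp_restr J v)) -addrA [leRHS]splitr.
  by rewrite (le_trans (ler_normD _ _))// lerD// distrC.
exists v, w; split; [exact: G0F|exact: G0F|by []|].
rewrite (_ : v - w = (lp_restr J v - lp_restr J w) + lp_restr (~` K) v
    - lp_restr (~` J) (lp_restr K w)
    + (lp_restr (~` J) (lp_restr K v) - lp_restr (~` K) w)).
  have := ler_normD (lp_restr J v - lp_restr J w + lp_restr (~` K) v
    - lp_restr (~` J) (lp_restr K w))
    (lp_restr (~` J) (lp_restr K v) - lp_restr (~` K) w).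
  have := ler_normB (lp_restr J v - lp_restr J w + lp_restr (~` K) v)
    (lp_restr (~` J) (lp_restr K w)).
  have := ler_normD (lp_restr J v - lp_restr J w) (lp_restr (~` K) v).
  move: near vK wM far; rewrite /e1; set a := 2 `^ _ * r; lra.
rewrite -{1}(lp_restrK J v) -{1}(lp_restrK J w) (resJC v) (resJC w).
by apply: lp_eq => i; rewrite !(lp_addE, lp_oppE); ring.
Qed.

End close_points.

(** * The lower bound *)

(** The norm of the plane l_q^2. It is locked because unifying through the real
    powers is expensive. *)
HB.lock Definition pnorm (R : realType) (q a b : R) : R :=
  (a `^ q + b `^ q) `^ q^-1.

Lemma pnormE (R : realType) (q a b : R) :
  pnorm q a b = (a `^ q + b `^ q) `^ q^-1.
Proof. by rewrite unlock. Qed.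

Section pnorm_theory.
Variables (R : realType) (q : R) (q1 : 1 <= q).
Implicit Types a b : R.

Let q0 : 0 < q. Proof. exact: lt_le_trans q1. Qed.

Lemma pnorm_ge0 a b : 0 <= pnorm q a b. Proof. by rewrite pnormE powR_ge0. Qed.

Lemma pnorm_pow a b : pnorm q a b `^ q = a `^ q + b `^ q.
Proof.
by rewrite pnormE -powRrM mulVf ?gt_eqF// powRr1// addr_ge0 ?powR_ge0.
Qed.

Lemma pnormC a b : pnorm q a b = pnorm q b a.
Proof. by rewrite !pnormE addrC. Qed.

Lemma pnormx0 a : 0 <= a -> pnorm q a 0 = a.
Proof.
move=> a0; rewrite pnormE (powR0 (negbT (gt_eqF q0))) addr0 -powRrM.
by rewrite mulfV ?gt_eqF// powRr1.
Qed.

Lemma pnorm_le a b a' b' : 0 <= a -> 0 <= b -> a <= a' -> b <= b' ->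
  pnorm q a b <= pnorm q a' b'.
Proof.
move=> a0 b0 aa bb; rewrite !pnormE; apply: powR_le_mono; rewrite ?invr_gt0 ?addr_ge0 ?powR_ge0//.
by rewrite lerD ?powR_le_mono.
Qed.

(** Minkowski's inequality, read off the sum of two copies of the line. *)
Lemma pnormD a b a' b' : 0 <= a -> 0 <= b -> 0 <= a' -> 0 <= b' ->
  pnorm q (a + a') (b + b') <= pnorm q a b + pnorm q a' b'.
Proof.
move=> a0 b0 a0' b0'.
have q1' : (1 <= q%:E)%E by rewrite lee_fin.
have := @lsum_normD R q%:E q1' R^o R^o (a, b) (a', b').
by rewrite unlock /= !ger0_norm ?addr_ge0// !pnormE.
Qed.

Lemma pnorm_gtl a b : 0 <= a -> 0 < b -> a < pnorm q a b.
Proof.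
move=> a0 b0; rewrite ltNge; apply/negP => /(powR_le_mono q0 (pnorm_ge0 a b)).
by rewrite pnorm_pow; apply/negP; rewrite -ltNge ltrDl powR_gt0.
Qed.

End pnorm_theory.

Section lsum_projections.
Variables (R : realType) (r : \bar R) (r1 : (1 <= r)%E) (X Y : normedModType R).
Implicit Types z : lsum r1 X Y.

Lemma lsum_norm_fin (s : R) z : r = s%:E -> `|z| = pnorm s `|z.1| `|z.2|.
Proof. by move=> rs; rewrite pnormE lsum_normrE unlock rs. Qed.

Lemma lsum_norm_max z : r = +oo%E -> `|z| = Num.max `|z.1| `|z.2|.
Proof. by move=> rs; rewrite lsum_normrE unlock rs. Qed.

Let r_cases (P : Prop) : ((exists2 s, r = s%:E & 1 <= s) -> P) -> (r = +oo%E -> P) -> P.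
Proof.
by case: r r1 => [s s1 /(_ (ex_intro2 _ _ s erefl s1))|_ _ /(_ erefl)|].
Qed.

Lemma lsum_fst_le z : `|z.1| <= `|z|.
Proof.
apply: r_cases => [[s rs s1]|rs].
  rewrite (lsum_norm_fin z rs).
  apply: (@le_trans _ _ (pnorm s `|z.1| 0)); first by rewrite pnormx0.
  exact: pnorm_le.
by rewrite (lsum_norm_max z rs) le_max lexx.
Qed.

Lemma lsum_snd_le z : `|z.2| <= `|z|.
Proof.
apply: r_cases => [[s rs s1]|rs].
  rewrite (lsum_norm_fin z rs) pnormC.
  apply: (@le_trans _ _ (pnorm s `|z.2| 0)); first by rewrite pnormx0.
  exact: pnorm_le.
by rewrite (lsum_norm_max z rs) le_max lexx orbT.
Qed.

Lemma lsum_le_add z : `|z| <= `|z.1| + `|z.2|.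
Proof.
apply: r_cases => [[s rs s1]|rs].
  rewrite (lsum_norm_fin z rs).
  have := @pnormD _ s s1 `|z.1| 0 0 `|z.2|.
  by rewrite addr0 add0r (pnormC s 0) !pnormx0//; apply.
by rewrite (lsum_norm_max z rs) ge_max lerDl lerDr !normr_ge0.
Qed.

End lsum_projections.

Section lower_bound.
Variables (R : realType) (p : R) (p1 : 1 <= p) (I : choiceType).
Hypothesis Iinf : infinite_set [set: I].
Notation lp := (lp p1 I).

Let p0 : 0 < p. Proof. exact: lt_le_trans p1. Qed.

(** The point [a] almost maximises the distance to the points [f u]. If all
    [F n] met the neighbourhood of [a] in a finite set, some coordinate i would
    be small in all the differences [a - f u] there, and the point
    [a + t *: lp_delta i] would be farther from all [f u] than the supremum of
    the distances. *)
Lemma crowded_point (T : Type) (Q : set T) (f : T -> lp) (s e : R) :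
  (forall a, exists2 u, Q u & `|a - f u| <= s) -> 0 < e ->
  exists a, forall (U : Type) (N : set U) (F : U -> set T),
    ~ ([set: I] #<= N) ->
    (forall u, Q u -> `|a - f u| <= s + e -> exists2 n, N n & F n u) ->
    exists2 n, N n & infinite_set (F n `&` [set u | Q u /\ `|a - f u| <= s + e]).
Proof.
move=> Qs e0.
pose S := [set c : R | exists a, forall u, Q u -> c <= `|a - f u|].
have Subs : ubound S s.
  by move=> c [a ac]; have [u Qu] := Qs a; apply: le_trans; exact: ac.
have S0 : S 0 by exists 0.
have Ssup : has_sup S by split; [exists 0|exists s].
set m0 := sup S.
have m00 : 0 <= m0 by apply: sup_ubound => //; exact: Ssup.2.
have m0s : m0 <= s by apply: ge_sup => //; exists 0.
pose t := e / 2; have t0 : 0 < t by rewrite divr_gt0.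
(* m is the gain in distance of a point at distance m0 from moving by t along
   a fresh coordinate; the errors made below add up to 3/4 of it. *)
pose m := pnorm p m0 t - m0.
have m_gt0 : 0 < m by rewrite subr_gt0 pnorm_gtl.
have m40 : 0 < m / 4 by rewrite divr_gt0.
have [c [a ac] m0c] := sup_adherent m40 Ssup; rewrite -/m0 in m0c.
exists a => U N F IN NF; apply: contrapT => nF.
pose A n := F n `&` [set u | Q u /\ `|a - f u| <= s + e].
have [i iP] : exists i, forall n, N n ->
    ~ (\bigcup_(u in A n) [set j | m / 4 <= `|(a - f u) j|]) i.
  apply: bigcup_finite_avoid => // n Nn; apply: bigcup_finite.
    by apply: contrapT => Ainf; apply: nF; exists n.
  by move=> u _; exact: lp_finite_large.
have : S (Num.min (m0 + m / 4) (m0 + t)).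
  exists (a + t *: lp_delta p1 i) => u Qu; rewrite ge_min.
  rewrite addrAC; set z := a - f u.
  have tdelta : `|t *: lp_delta p1 i| = t by rewrite normrZ lp_norm_delta mulr1 gtr0_norm.
  (* A point far from a stays far, since a moves by t = e / 2 only. *)
  have [zs|zs] := leP `|z| (s + e); last first.
    apply/orP; right.
    have := lerB_dist z (- (t *: lp_delta p1 i)); rewrite opprK normrN tdelta.
    move: zs m0s; rewrite /t; lra.
  apply/orP; left.
  have [n Nn Fnu] := NF _ Qu zs.
  have zi : `|z i| <= m / 4.
    by rewrite leNgt; apply/negP => zi; apply: (iP _ Nn); exists u => //; exact: ltW.
  have zc : c <= `|z| by exact: ac.
  pose z' := z - z i *: lp_delta p1 i.
  have z'i : z' i = 0.
    by rewrite /z' lp_addE lp_oppE lp_scaleE lp_deltaE eqxx mulr1 subrr.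
  have zi' : `|z i *: lp_delta p1 i| = `|z i| by rewrite normrZ lp_norm_delta mulr1.
  have z'z : `|z| - `|z i| <= `|z'| by rewrite -zi' lerB_dist.
  have z'E : `|z' + t *: lp_delta p1 i| = pnorm p `|z'| t.
    rewrite pnormE -{2}(gtr0_norm t0) -(lp_powD_delta t z'i) -powRrM.
    by rewrite mulfV ?gt_eqF// powRr1.
  have zz' : `|z' + t *: lp_delta p1 i| <= `|z + t *: lp_delta p1 i| + `|z i|.
    rewrite -zi' /z' addrAC; exact: ler_normB.
  have near : pnorm p m0 t <= pnorm p `|z'| t + m / 2.
    have m20 : 0 <= m / 2 by rewrite divr_ge0// ltW.
    have := @pnormD _ p p1 `|z'| t (m / 2) 0 (normr_ge0 _) (ltW t0) m20 (lexx 0).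
    rewrite addr0 (pnormx0 p1 m20); apply: le_trans.
    apply: pnorm_le => //; first exact: ltW.
    by move: m0c zc zi z'z; lra.
  move: near zz' zi; rewrite z'E /m.
  move: (pnorm p m0 t) (pnorm p `|z'| t) `|z + _| `|z i| => h1 h2 h3 h4.
  by clear; lra.
move=> /(sup_ubound Ssup.2); rewrite leNgt -/m0 lt_min !ltrDl m40 t0.
by [].
Qed.

Lemma lp_lsum_gamma_ge (Y : normedModType R) (r : \bar R) (r1 : (1 <= r)%E) :
  dens_lt Y [set: I] ->
  ((2 / 2 `^ p^-1)%:E <= gamma (lsum r1 lp Y))%E.
Proof.
move=> dY; apply: le_ereal_inf_tmp => _ [s [s0 [P [Ps Psep]]] <-]; rewrite lee_fin.
have k0 : 0 < 2 `^ p^-1 :> R by rewrite powR_gt0.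
rewrite ler_pdivrMr//; apply/ler_addgt0Pr => e e0.
pose k := 2 `^ p^-1 : R.
(* d is chosen so that the total error d (k + 2) is at most e; d <= 1 < 2 makes
   the l_p-components of the selected points distinct. *)
pose d := Num.min 1 (e / (k + 2)).
have k20 : 0 < k + 2 by rewrite addr_gt0.
have d0 : 0 < d by rewrite lt_min ltr01 divr_gt0.
have d1 : d <= 1 by rewrite ge_min lexx.
have dk : d * (k + 2) <= e by rewrite -ler_pdivlMr// ge_min lexx orbT.
pose Q := [set u : lsum r1 lp Y | P u /\ `|u.2| <= s].
have Qs a : exists2 u, Q u & `|a - u.1| <= s.
  have [u Pu au] := Ps ((a, 0) : lsum r1 lp Y).
  exists u; last exact: le_trans (lsum_fst_le _) au.
  split=> //; apply: le_trans au.
  by have := lsum_snd_le (((a, 0) : lsum r1 lp Y) - u); rewrite /= sub0r normrN.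
have [a aP] := crowded_point Qs d0.
have [N IN NP] := @dens_lt_net _ _ I s (d / 2) Iinf dY (divr_gt0 d0 (ltr0n R 2)).
have [u [Pu us] _|n Nn Ginf] := aP _ N (fun n => [set u | `|u.2 - n| <= d / 2]) IN.
  exact: NP.
set G := _ `&` _ in Ginf.
have Gsep u v : G u -> G v -> u <> v -> 2 <= `|u.1 - v.1| + d.
  move=> [/= un [[Pu _] _]] [/= vn [[Pv _] _]] uv.
  apply: le_trans (Psep _ _ Pu Pv uv) _; apply: le_trans (lsum_le_add _) _.
  have -> : (u - v).2 = (u.2 - n) + (n - v.2) by rewrite addrA subrK.
  rewrite lerD2l [leRHS]splitr.
  by rewrite (le_trans (ler_normD _ _))// lerD// distrC.
have inj : {in G &, injective (fun u : lsum r1 lp Y => a - u.1)}.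
  move=> u v /[!inE] Gu Gv /addrI/oppr_inj uv; apply: contrapT => nuv.
  have := Gsep _ _ Gu Gv nuv; rewrite uv subrr normr0 add0r leNgt.
  by rewrite (le_lt_trans d1)// ltr1n.
have FG := inj_card_eq inj.
have [] := @lp_infinite_close _ _ p1 I ((fun u : lsum r1 lp Y => a - u.1) @` G)
  (s + d) d _ _ d0.
- by rewrite (eq_finite_set FG).
- by move=> _ [u [_ [_ us]] <-].
move=> _ [_ [[u Gu <-] [v Gv <-] auv]].
have uv : u <> v by move=> uv; apply: auv; rewrite uv.
rewrite opprB addrC addrA subrK distrC -/k => uvk.
have arith (n' k' d' : R) : n' <= k' * (s + d') + d' -> d' * (k' + 2) <= e ->
    2 <= n' + d' -> 2 <= s * k' + e.
  by rewrite !mulrDr !(mulrC d') [s * _]mulrC; lra.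
exact: arith uvk dk (Gsep _ _ Gu Gv uv).
Qed.

End lower_bound.

(** * Greedy lattices *)

(** The abstract form of the construction. The vector [e w] is t times a unit
    vector, [c w] reads its coordinate, and the rank [rk] ensures that the
    coordinate attached to [w] is not seen by any other vector of rank at most
    [rk w]. A rank is treated in one step: the condition that [x w] be far from
    the group refers only to the group generated in lower ranks, because two
    nonzero coefficients of the same rank already force norm at least 2. *)
Section greedy_lattice.
Variables (R : realType) (V : normedModType R) (W : choiceType).
Variables (t : R) (rk : W -> nat) (x e : W -> V) (c : W -> V -> R).
Hypothesis t_gt0 : 0 < t.
Hypothesis cB : forall w u v, c w (u - v) = c w u - c w v.
Hypothesis cx : forall v w, (rk v <= rk w)%N -> c w (x v) = 0.
Hypothesis ce : forall v w, (rk v <= rk w)%N -> c w (e v) = t *+ (v == w).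
Hypothesis e_le : forall w, `|e w| <= t.
Hypothesis xdense : forall z (d : R), 0 < d -> exists w, `|z - x w| < d.
Hypothesis fresh_ge : forall w z, c w z = 0 -> t <= `|z| -> 2 <= `|z + e w|.
Hypothesis two_ge : forall v w z, v != w -> t <= `|c v z| -> t <= `|c w z| ->
  2 <= `|z|.
Hypothesis coord_ge : forall w z, t *+ 2 <= `|c w z| -> 2 <= `|z|.

Let d w := x w + e w.

Let selected (G : set V) n w := rk w = n /\ forall h, G h -> t <= `|x w - h|.

(** Elements of the next group are written with two lists, positive and negative
    terms with repetitions: differences are then concatenations, and the
    coefficient of [d w] is a difference of multiplicities. *)
Fixpoint greedy n : set V :=
  if n is m.+1 then
    [set g | exists h s1 s2, [/\ greedy m h,
      forall w, w \in s1 -> selected (greedy m) m w,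
      forall w, w \in s2 -> selected (greedy m) m w
      & g = h + (\sum_(w <- s1) d w - \sum_(w <- s2) d w)]]
  else [set 0].

Lemma greedy_mono m n : (m <= n)%N -> greedy m `<=` greedy n.
Proof.
elim: n => [|n IH]; first by rewrite leqn0 => /eqP ->.
rewrite leq_eqVlt => /orP[/eqP ->//|/IH mn] g /mn gn.
by exists g, [::], [::]; split=> //; rewrite !big_nil subr0 addr0.
Qed.

Lemma greedy0 n : greedy n 0. Proof. by apply: (@greedy_mono 0). Qed.

Lemma greedyB n g h : greedy n g -> greedy n h -> greedy n (g - h).
Proof.
elim: n g h => [g h -> ->|n IH _ _ [g [s1 [s2 [gn S1 S2 ->]]]] [h [s3 [s4 [hn S3 S4 ->]]]]].
  by rewrite subr0.
exists (g - h), (s1 ++ s4), (s2 ++ s3); split.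
- exact: IH.
- by move=> w; rewrite mem_cat => /orP[/S1|/S4].
- by move=> w; rewrite mem_cat => /orP[/S2|/S3].
- rewrite !big_cat /= !opprD !opprK addrACA; congr (_ + _).
  by rewrite [- _ + \sum_(w <- s4) _]addrC addrACA.
Qed.

Lemma greedyN n g : greedy n g -> greedy n (- g).
Proof. by move=> /(greedyB (greedy0 n)); rewrite sub0r. Qed.

Let c0 w : c w 0 = 0.
Proof. by rewrite -(subrr 0) cB subrr. Qed.

Let cD w u v : c w (u + v) = c w u + c w v.
Proof. by rewrite -{1}[v]opprK -(sub0r v) !cB c0 sub0r opprK. Qed.

Let c_sum w s : (forall v, v \in s -> (rk v <= rk w)%N) ->
  c w (\sum_(v <- s) d v) = t *+ count_mem w s.
Proof.
elim: s => [|v s IH] sw; first by rewrite big_nil c0.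
rewrite big_cons cD IH => [|u us]; last by apply: sw; rewrite inE us orbT.
have vw : (rk v <= rk w)%N by apply: sw; rewrite mem_head.
by rewrite /d cD cx// ce// add0r -mulrnDr.
Qed.

Lemma greedy_coord n g w : greedy n g -> (n <= rk w)%N -> c w g = 0.
Proof.
elim: n g => [_ -> _|n IH _ [h [s1 [s2 [hn S1 S2 ->]]]] nw]; first exact: c0.
have zero s : (forall w, w \in s -> selected (greedy n) n w) ->
    c w (\sum_(v <- s) d v) = 0.
  move=> S; rewrite c_sum => [|v /S[-> _]]; last exact: ltnW.
  rewrite (count_memPn _) ?mulr0n//; apply/negP => /S[wn _].
  by rewrite wn ltnn in nw.
by rewrite cD cB (IH _ hn (ltnW nw)) (zero _ S1) (zero _ S2) subr0 addr0.
Qed.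

(* The separation of an element with a nonzero coefficient on the top rank,
   up to sign a positive one, by cases: it is at least 2; another coefficient of
   that rank is nonzero; it equals 1 and is the only nonzero one. *)
Let greedy_step n h s1 s2 w : greedy n h ->
  (forall w, w \in s1 -> selected (greedy n) n w) ->
  (forall w, w \in s2 -> selected (greedy n) n w) ->
  (count_mem w s2 < count_mem w s1)%N ->
  2 <= `|h + (\sum_(w <- s1) d w - \sum_(w <- s2) d w)|.
Proof.
move=> hn S1 S2 w21; set g := h + _.
have rk_le s v : (forall w, w \in s -> selected (greedy n) n w) ->
    rk v = n -> forall u, u \in s -> (rk u <= rk v)%N.
  by move=> S vn u /S[-> _]; rewrite vn.
have cg v : rk v = n -> c v g = t *+ count_mem v s1 - t *+ count_mem v s2.
  move=> vn; rewrite /g cD cB (greedy_coord hn) ?vn// add0r.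
  by rewrite !c_sum//; exact: rk_le.
have ws1 : w \in s1.
  by rewrite -has_pred1 has_count; exact: leq_ltn_trans w21.
have [wn whn] := S1 _ ws1.
have [w2|w1] := ltnP (count_mem w s2).+1 (count_mem w s1).
  apply: (@coord_ge w); rewrite cg// -mulrnBr 1?ltnW// normrMn gtr0_norm//.
  by rewrite ler_pMn2l// leq_subRL// ?addn2// 1?ltnW.
have {w1 w21}w12 : count_mem w s1 = (count_mem w s2).+1.
  by apply/eqP; rewrite eqn_leq w1.
have [[v [vw v12]]|same] := pselect (exists v, v != w /\ count_mem v s1 != count_mem v s2).
  have vn : rk v = n.
    have [/S1[]//|v1] := boolP (v \in s1).
    have [/S2[]//|v2] := boolP (v \in s2).
    by move: v12; rewrite (count_memPn v1) (count_memPn v2).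
  apply: (two_ge vw); last first.
    by rewrite cg// w12 mulrS addrAC subrK gtr0_norm.
  rewrite cg//; case: (ltngtP (count_mem v s1) (count_mem v s2)) v12 => // lt _.
    rewrite distrC -mulrnBr 1?ltnW// normrMn gtr0_norm//.
    by rewrite -[leLHS]mulr1n ler_pMn2l// subn_gt0.
  rewrite -mulrnBr 1?ltnW// normrMn gtr0_norm//.
  by rewrite -[leLHS]mulr1n ler_pMn2l// subn_gt0.
have s12 : perm_eq s1 (w :: s2).
  apply/allP => v _ /=; apply/eqP; have [->|vw] := eqVneq v w.
    by rewrite w12.
  rewrite add0n; apply: contrapT => /eqP v12.
  by apply: same; exists v.
rewrite /g (perm_big _ s12) /= big_cons addrK /d addrA.
apply: fresh_ge; first by rewrite cD (greedy_coord hn) ?wn// cx// addr0.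
by have := whn _ (greedyN hn); rewrite opprK addrC.
Qed.

(** If all coefficients on the top rank vanish, the element lies in the previous
    group. *)
Lemma greedy_separated n g : greedy n g -> g <> 0 -> 2 <= `|g|.
Proof.
elim: n g => [//|n IH _ [h [s1 [s2 [hn S1 S2 ->]]]]] g0.
have [same|] := pselect (forall w, count_mem w s1 = count_mem w s2).
  have s12 : perm_eq s1 s2 by apply/allP => v _ /=; rewrite same.
  move: g0; rewrite (perm_big _ s12) /= subrr addr0; exact: IH.
move=> /existsNP[w /eqP]; rewrite neq_ltn => /orP[w12|w21]; last first.
  exact: (greedy_step hn S1 S2 w21).
by rewrite -normrN opprD opprB; exact: (greedy_step (greedyN hn) S2 S1 w12).
Qed.

(** A selected [x w] is at distance at most t from [d w]; one that was not
    selected is within t of the group of lower rank. *)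
Lemma greedy_lattice : (gamma_star V <= t%:E)%E.
Proof.
apply/lee_addgt0Pr => r r0; apply: ereal_inf_lbound.
exists (t + r) => //; split; first by rewrite addr_gt0.
exists (\bigcup_n greedy n).
have PB g h : (\bigcup_n greedy n) g -> (\bigcup_n greedy n) h ->
    (\bigcup_n greedy n) (g - h).
  move=> [n _ gn] [m _ hm]; exists (maxn n m) => //; apply: greedyB.
    by apply: greedy_mono gn; exact: leq_maxl.
  by apply: greedy_mono hm; exact: leq_maxr.
split.
- split=> [|g h]; first by rewrite inE; exists 0%N.
  by rewrite !inE; exact: PB.
- move=> z; have [w zw] := xdense z r0.
  have [[h hw xh]|far] := pselect (exists2 h, greedy (rk w) h & `|x w - h| < t).
    exists h; first by exists (rk w).
    rewrite -(subrK (x w) z) -addrA [leRHS]addrC.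
    by rewrite (le_trans (ler_normD _ _))// lerD// ltW.
  exists (d w).
    exists (rk w).+1 => //; exists 0, [:: w], [::]; split=> //.
    + exact: greedy0.
    + move=> v; rewrite inE => /eqP ->; split=> // h hw.
      by rewrite leNgt; apply/negP => xh; apply: far; exists h.
    + by rewrite big_seq1 big_nil subr0 add0r.
  rewrite /d opprD addrA [leRHS]addrC (le_trans (ler_normB _ _))//.
  by rewrite lerD// ltW.
- move=> g h Pg Ph gh; have [n _ ghn] := PB _ _ Pg Ph.
  by apply: greedy_separated ghn _; move=> /eqP; rewrite subr_eq0 => /eqP.
Qed.

End greedy_lattice.

(** * The upper bounds *)

Section fresh_lattice.
Variables (R : realType) (p : R) (p1 : 1 <= p) (I : choiceType).
Notation lp := (lp p1 I).
Hypothesis Iinf : infinite_set [set: I].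

Let p0 : 0 < p. Proof. exact: lt_le_trans p1. Qed.

(** The hypotheses of [greedy_lattice] when V has l_p(I) as a 1-complemented
    summand, through [pi] and [iota]. An injection f of T * nat into I splits
    part of I into levels, f (w, m) having level m + 1. The rank of w bounds the
    levels of the support of [pi (x w)], and w is given the coordinate
    f (w, rank w), which lies one level higher. *)
Lemma fresh_lattice (V : normedModType R) (pi : V -> lp) (iota : lp -> V)
    (T : choiceType) (x : T -> V) (t : R) :
  (forall u v, pi (u - v) = pi u - pi v) ->
  (forall a, pi (iota a) = a) ->
  (forall a, `|iota a| <= `|a|) ->
  (forall z, `|pi z| <= `|z|) ->
  1 <= t -> 2 `^ p <= t `^ p *+ 2 ->
  (forall z i, pi z i = 0 -> t <= `|z| -> 2 <= `|z + iota (t *: lp_delta p1 i)|) ->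
  [set: T] #<= [set: I] ->
  (forall z (d : R), 0 < d -> exists w, `|z - x w| < d) ->
  (forall w, exists s : seq I, forall i, i \notin s -> pi (x w) i = 0) ->
  (gamma_star V <= t%:E)%E.
Proof.
move=> piB piK iota_le pi_le t1 tp fresh TI xdense xfin.
have t0 : 0 < t by rewrite (lt_le_trans _ t1).
have [f fi] := infinite_inj_nat Iinf TI.
have /choice[lev levP] : forall i, exists n, forall w m, f (w, m) = i -> n = m.+1.
  move=> i; have [[[w m] fwm]|nf] := pselect (exists u, f u = i).
    by exists m.+1 => w' m'; rewrite -fwm => /fi[_ ->].
  by exists 0%N => w m fi'; case: nf; exists (w, m).
have /choice[rk rkP] : forall w, exists n, forall i, pi (x w) i <> 0 -> (lev i <= n)%N.
  move=> w; have [s sP] := xfin w; exists (\max_(i <- s) lev i) => i xi.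
  have si : i \in s by apply: contrapT => /negP/sP.
  by rewrite (big_rem i si)/= leq_maxl.
pose i_ w := f (w, rk w).
have two v w z : v != w -> t <= `|pi z (i_ v)| -> t <= `|pi z (i_ w)| -> 2 <= `|z|.
  move=> vw tv tw; apply: le_trans (pi_le z); apply: (powR_le_inv p0) => //.
  apply: le_trans tp _; rewrite mulr2n.
  apply: le_trans (@lp_two_coords_le _ _ p1 _ (pi z) (i_ v) (i_ w) _).
    by rewrite lerD// powR_le_mono// ltW.
  by apply/eqP => /fi[vw' _]; rewrite vw' eqxx in vw.
apply: (@greedy_lattice R V T t rk x (fun w => iota (t *: lp_delta p1 (i_ w)))
  (fun w z => pi z (i_ w))) => //.
- by move=> w u v; rewrite piB.
- move=> v w vw; apply: contrapT => /rkP; rewrite (levP _ _ _ erefl).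
  by rewrite leqNgt ltnS vw.
- move=> v w vw; rewrite piK lp_scaleE lp_deltaE.
  have [->|vw'] := eqVneq v w; first by rewrite eqxx mulr1.
  rewrite mulr0n; case: eqP => [/fi[vw'' _]|]; last by rewrite mulr0.
  by rewrite vw'' eqxx in vw'.
- move=> w; apply: le_trans (iota_le _) _.
  by rewrite normrZ lp_norm_delta mulr1 gtr0_norm.
- by move=> w z; exact: fresh.
- move=> w z tz; apply: le_trans (pi_le z); apply: le_trans (lp_coord_le _ (i_ w)).
  by apply: le_trans tz; rewrite ler_pMn2r.
Qed.

End fresh_lattice.

Section separation_constant.
Variables (R : realType).

(** Two coordinates of this size have l_q norm exactly 2. *)
Lemma two_div_root_pow (q : R) : 1 <= q -> (2 / 2 `^ q^-1) `^ q *+ 2 = 2 `^ q.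
Proof.
move=> q1; have q0 : 0 < q by rewrite (lt_le_trans _ q1).
have h0 : 0 < 2 `^ q^-1 :> R by rewrite powR_gt0.
have hq : (2 `^ q^-1) `^ q = 2 by rewrite -powRrM mulVf ?gt_eqF// powRr1.
rewrite -mulr_natr -[X in _ * X]hq -powRM ?divr_ge0 ?(ltW h0)//.
by rewrite divfK ?gt_eqF.
Qed.

Lemma two_div_root_ge1 (q : R) : 1 <= q -> 1 <= 2 / 2 `^ q^-1.
Proof.
move=> q1; have q0 : 0 < q by rewrite (lt_le_trans _ q1).
rewrite ler_pdivlMr ?powR_gt0// mul1r -[leRHS]powRr1//.
by rewrite ler_powR ?ler1n// invf_le1.
Qed.

Lemma two_div_root_le (p q : R) : 1 <= p -> p <= q ->
  2 / 2 `^ p^-1 <= 2 / 2 `^ q^-1 :> R.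
Proof.
move=> p1 pq; have p0 : 0 < p by rewrite (lt_le_trans _ p1).
rewrite ler_pM2l// lef_pV2 ?posrE ?powR_gt0//.
by rewrite ler_powR ?ler1n// lef_pV2 ?posrE// (lt_le_trans p0).
Qed.

(** The r-th power turns l_p norms into l_(p/r) norms: this reduces mixed-norm
    inequalities to the triangle inequality for the exponent p / r. *)
Lemma pnorm_powr (p r a b : R) : 0 < p -> 0 < r -> 0 <= a -> 0 <= b ->
  pnorm p a b `^ r = pnorm (p / r) (a `^ r) (b `^ r).
Proof.
move=> p0 r0 a0 b0; rewrite !pnormE -!powRrM invf_div.
by rewrite !(mulrC r) !divfK ?gt_eqF// [p^-1 * r]mulrC.
Qed.

(** The triangle inequality of l_(p/r), p / r >= 1, applied to the vectors
    (a^r, t^r) and (b^r, 0). *)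
Lemma pnorm_mixed (p r a b t : R) : 1 <= r -> r <= p ->
  0 <= a -> 0 <= b -> 0 <= t ->
  pnorm p (pnorm r a b) t <= pnorm r (pnorm p a t) b.
Proof.
move=> r1 rp a0 b0 t0; have r0 : 0 < r by rewrite (lt_le_trans _ r1).
have p0 : 0 < p by rewrite (lt_le_trans r0).
have k1 : 1 <= p / r by rewrite ler_pdivlMr// mul1r.
apply: (powR_le_inv r0); [exact: pnorm_ge0|exact: pnorm_ge0|].
rewrite (pnorm_powr p0 r0 (pnorm_ge0 _ _ _) t0) !(pnorm_pow r1).
rewrite (pnorm_powr p0 r0 a0 t0).
have := @pnormD _ (p / r) k1 (a `^ r) (t `^ r) (b `^ r) 0.
by rewrite addr0 (pnormx0 k1) ?powR_ge0//; apply.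
Qed.

Lemma pnorm_antimono (p r a b : R) : 1 <= p -> p <= r -> 0 <= a -> 0 <= b ->
  pnorm r a b <= pnorm p a b.
Proof.
move=> p1 pr a0 b0; have p0 : 0 < p by rewrite (lt_le_trans _ p1).
have r1 := le_trans p1 pr; have r0 : 0 < r by rewrite (lt_le_trans p0).
have k1 : 1 <= r / p by rewrite ler_pdivlMr// mul1r.
apply: (powR_le_inv p0); [exact: pnorm_ge0|exact: pnorm_ge0|].
rewrite (pnorm_powr r0 p0 a0 b0) (pnorm_pow p1).
have := @pnormD _ (r / p) k1 (a `^ p) 0 0 (b `^ p).
rewrite addr0 add0r (pnormC _ 0) !(pnormx0 k1) ?powR_ge0//; exact.
Qed.

End separation_constant.

Section upper_bounds.
Variables (R : realType) (p : R) (p1 : 1 <= p) (I : choiceType).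
Notation lp := (lp p1 I).
Hypothesis Iinf : infinite_set [set: I].

Let p0 : 0 < p. Proof. exact: lt_le_trans p1. Qed.

Lemma lp_gamma_star_le : (gamma_star lp <= (2 / 2 `^ p^-1)%:E)%E.
Proof.
apply: (@fresh_lattice _ _ p1 I Iinf lp id id _ (rat_comb (@lp_delta _ _ p1 I))) => //.
- exact: two_div_root_ge1.
- by rewrite two_div_root_pow.
- move=> z i zi tz; apply: (powR_le_inv p0) => //.
  have t0 : 0 <= 2 / 2 `^ p^-1 :> R by rewrite divr_ge0 ?powR_ge0.
  rewrite (lp_powD_delta _ zi) -(two_div_root_pow p1) mulr2n (ger0_norm t0).
  by rewrite lerD2r powR_le_mono.
- exact: card_le_seq_rat.
- by move=> z d; apply: dense_rat_comb; exact: lp_dense_span.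
- by move=> w; exists (map snd w) => i; exact: rat_comb_delta0.
Qed.

(** In the l_p-component the fresh coordinate contributes as in a plane l_p^2.
    For r <= p the mixed-norm inequality moves it outside the sum with Y, where
    it has to be compared with t in l_p^2; for p <= r it contributes at least as
    much as in l_r^2, and then everything takes place in l_r. *)
Lemma lsum_fresh_ge (Y : normedModType R) (r t : R) (r1 : (1 <= r%:E)%E)
    (z : lsum r1 lp Y) i :
  t = 2 / 2 `^ (Num.max p r)^-1 -> z.1 i = 0 -> t <= `|z| ->
  2 <= `|z + ((t *: lp_delta p1 i, 0) : lsum r1 lp Y)|.
Proof.
move=> tE zi; rewrite !(@lsum_norm_fin _ _ _ _ _ r)//=.
have r1' : 1 <= r by rewrite -lee_fin.
have r0 : 0 < r by rewrite (lt_le_trans _ r1').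
have t0 : 0 <= t by rewrite tE divr_ge0 ?powR_ge0.
have -> : `|z.1 + t *: lp_delta p1 i| = pnorm p `|z.1| t.
  rewrite pnormE -{2}(ger0_norm t0) -(lp_powD_delta t zi) -powRrM.
  by rewrite mulfV ?gt_eqF// powRr1.
rewrite addr0 => tz.
have [rp|pr] := leP r p.
  apply: (le_trans _ (pnorm_mixed r1' rp (normr_ge0 _) (normr_ge0 _) t0)).
  apply: (powR_le_inv p0); [by []|exact: pnorm_ge0|].
  rewrite (pnorm_pow p1) -two_div_root_pow//.
  move: tE; rewrite (max_idPl rp) => <-; rewrite mulr2n lerD2r.
  exact: powR_le_mono.
have {}pr := ltW pr.
apply: (le_trans _ (pnorm_le r1' (pnorm_ge0 _ _ _) (normr_ge0 _)
  (pnorm_antimono p1 pr (normr_ge0 _) t0) (lexx _))).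
apply: (powR_le_inv r0); [by []|exact: pnorm_ge0|].
rewrite !(pnorm_pow r1') addrAC -(pnorm_pow r1') -two_div_root_pow//.
move: tE; rewrite (max_idPr pr) => <-; rewrite mulr2n lerD2r.
exact: powR_le_mono.
Qed.

Lemma lp_lsum_gamma_star_le (Y : normedModType R) (r : R) (r1 : (1 <= r%:E)%E) :
  dens_lt Y [set: I] ->
  (gamma_star (lsum r1 lp Y) <= (2 / 2 `^ (Num.max p r)^-1)%:E)%E.
Proof.
move=> [D [dD _] /andP[DI _]].
have q1 : 1 <= Num.max p r by rewrite le_max p1.
have pq : p <= Num.max p r by rewrite le_max lexx.
pose x (w : seq (rat * I) * seq (rat * D)) : lsum r1 lp Y :=
  (rat_comb (@lp_delta _ _ p1 I) w.1, rat_comb (val : D -> Y) w.2).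
apply: (@fresh_lattice _ _ p1 I Iinf (lsum r1 lp Y) fst (fun a => (a, 0)) _ x) => //.
- move=> a; apply: le_trans (lsum_le_add _) _.
  by rewrite /= normr0 addr0.
- exact: lsum_fst_le.
- exact: two_div_root_ge1.
- rewrite -(two_div_root_pow p1); apply: ler_wMn2r.
  apply: (powR_le_mono p0 _ (two_div_root_le p1 pq)).
  exact: le_trans (two_div_root_ge1 p1).
- by move=> z i; exact: lsum_fresh_ge.
- apply: card_le_setX_self => //; first exact: card_le_seq_rat.
  apply: card_le_trans (card_le_seq_rat Iinf).
  apply: card_le_seq_rat_mono; apply: card_le_trans DI.
  by have /card_eqPle[] := card_setT D.
- move=> z d d0; have d20 : 0 < d / 2 by rewrite divr_gt0.
  have [l1 h1] := dense_rat_comb (@lp_dense_span _ _ p1 I) z.1 d20.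
  have [l2 h2] := dense_rat_comb_set dD z.2 d20.
  exists (l1, l2); apply: le_lt_trans (lsum_le_add _) _.
  by rewrite [ltRHS]splitr ltrD.
- by move=> w; exists (map snd w.1) => i; exact: rat_comb_delta0.
Qed.

End upper_bounds.

Lemma gamma_le_gamma_star (R : realType) (X : normedModType R) :
  (gamma X <= gamma_star X)%E.
Proof.
apply: ereal_inf_le_tmp => _ [s [s0 [P [_ Ps P2]]] <-].
by exists s => //; split=> //; exists P.
Qed.

Lemma gamma_star_lsum_pinfty (R : realType) (X Y : normedModType R)
    (r1 : (1 <= +oo :> \bar R)%E) :
  (gamma_star (lsum r1 X Y) <= maxe (gamma_star X) (gamma_star Y))%E.
Proof.
rewrite leNgt; apply/negP; rewrite gt_max => /andP[].
move=> /ereal_inf_lt[_ [s [s0 [P [[P0 PB] Ps P2]]] <-] sg].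
move=> /ereal_inf_lt[_ [s' [s'0 [Q [[Q0 QB] Qs Q2]]] <-] s'g].
have : (gamma_star (lsum r1 X Y) <= (Num.max s s')%:E)%E.
  apply: ereal_inf_lbound; exists (Num.max s s') => //.
  split; first by rewrite lt_max s0.
  exists [set z | P z.1 /\ Q z.2]; split.
  - split=> [|z w].
      by move: P0 Q0; rewrite !inE.
    rewrite !inE /= => -[Pz Qz] [Pw Qw]; split.
      by have := PB _ _ (mem_set Pz) (mem_set Pw); rewrite inE.
    by have := QB _ _ (mem_set Qz) (mem_set Qw); rewrite inE.
  - move=> z; have [u Pu zu] := Ps z.1; have [v Qv zv] := Qs z.2.
    exists (u, v) => //; rewrite lsum_norm_max// ge_max !le_max zu zv.
    by rewrite orbT.
  - move=> z w [Pz Qz] [Pw Qw] zw; rewrite lsum_norm_max// le_max /=.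
    have [zw1|zw1] := pselect (z.1 = w.1); last by rewrite P2.
    rewrite orbC Q2// => zw2; apply: zw.
    by case: z w zw1 zw2 {Pz Qz Pw Qw} => a b [a' b'] /= -> ->.
rewrite leNgt; apply/negP/negPn; rewrite EFin_max gt_max.
by rewrite sg s'g.
Qed.

Theorem theorem6p9 (R : realType) (p : R) (p1 : 1 <= p) (I : choiceType)
    (Y : normedModType R)
    (Iinf : infinite_set [set: I]) (densY : dens_lt Y [set: I]) :
  [/\ forall (r : R) (r1 : (1 <= r%:E)%E), r <= p ->
        gamma (lsum r1 (lp p1 I) Y) = (2 / 2 `^ p^-1)%:E /\
        gamma_star (lsum r1 (lp p1 I) Y) = (2 / 2 `^ p^-1)%:E,
      forall (r : R) (r1 : (1 <= r%:E)%E), p <= r ->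
        [/\ ((2 / 2 `^ p^-1)%:E <= gamma (lsum r1 (lp p1 I) Y))%E,
            (gamma (lsum r1 (lp p1 I) Y)
               <= gamma_star (lsum r1 (lp p1 I) Y))%E
          & (gamma_star (lsum r1 (lp p1 I) Y) <= (2 / 2 `^ r^-1)%:E)%E]
    & forall r1 : (1 <= +oo)%E,
        [/\ ((2 / 2 `^ p^-1)%:E <= gamma (lsum r1 (lp p1 I) Y))%E,
            (gamma (lsum r1 (lp p1 I) Y)
               <= gamma_star (lsum r1 (lp p1 I) Y))%E
          & (gamma_star (lsum r1 (lp p1 I) Y)
               <= maxe (2 / 2 `^ p^-1)%:E (gamma_star Y))%E]].
Proof.
split=> [r r1 rp|r r1 pr|r1].
- have lower := lp_lsum_gamma_ge p1 Iinf r1 densY.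
  have upper := lp_lsum_gamma_star_le p1 Iinf r1 densY.
  rewrite (max_idPl rp) in upper.
  have mid := gamma_le_gamma_star (lsum r1 (lp p1 I) Y).
  split; apply/le_anti/andP; split=> //.
    exact: le_trans mid upper.
  exact: le_trans lower mid.
- split; [exact: lp_lsum_gamma_ge|exact: gamma_le_gamma_star|].
  by have := lp_lsum_gamma_star_le p1 Iinf r1 densY; rewrite (max_idPr pr).
- split; [exact: lp_lsum_gamma_ge|exact: gamma_le_gamma_star|].
  apply: le_trans (gamma_star_lsum_pinfty _ _ r1) _.
  rewrite ge_max !le_max lexx orbT andbT.
  by rewrite lp_gamma_star_le.
Qed.
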